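(* Let $\zeta$ denote a subordinator with self-decomposable laws, such that the quantile clock $T_U$ with parameters $(U,Z)$ ($U$ uniform on $[0,1]$) has marginals $T_U(t)\stackrel{d}{=}\zeta(t)$; this is achieved by setting the Lévy density of $Z$ to be $$\rho_Z(x)=-x\rho'_\zeta(x)=\rho_\zeta(x)+\rho_\vartheta(x),$$ where $\vartheta$ is the OU--BDLP of $v(0)\stackrel{d}{=}T_U(1)\stackrel{d}{=}\zeta(1)$. Let $\varepsilon>0$. Then for $Z$ with this Lévy density, the short memory convoluted subordinator $$\tilde T_\varepsilon(t)=\int_0^t\min\Big(1,\frac{(t-s)_+}{\varepsilon}\Big)Z(ds)$$ has the following distributional properties. (i) For each fixed $t$, the Laplace exponent of the random variable $\tilde T_\varepsilon(t)$ is $$\psi_{\tilde T_\varepsilon(t)}(\omega)=\begin{cases} t\,\psi_\zeta\big(\omega\frac t\varepsilon\big), & t\le\varepsilon,\\ t\,\psi_\zeta(\omega)+(t-\varepsilon)\,\omega\psi'_\zeta(\omega), & t>\varepsilon.\end{cases}$$ (ii) For each fixed $t$, the marginal distribution of $\tilde T_\varepsilon(t)$ is given by $$\tilde T_\varepsilon(t)\stackrel{d}{=}\begin{cases}\frac t\varepsilon\,\zeta(t), & t\le\varepsilon,\\ \zeta(t)+\vartheta(t-\varepsilon), & t>\varepsilon,\end{cases}$$ with $\zeta$ and $\vartheta$ independent.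
   Context: A subordinator $\zeta$ is an increasing right-continuous process started at $0$ with stationary independent increments, zero drift, and $\mathbb{E}[e^{-\omega\zeta(t)}]=e^{-t\psi_\zeta(\omega)}$, $\psi_\zeta(\omega)=\int_0^\infty(1-e^{-\omega s})\rho_\zeta(s)ds$, with $\rho_\zeta$ the Lévy density. For a nonnegative random variable $X$, $\psi_X(\omega)=-\log\mathbb{E}[e^{-\omega X}]$. $(a)_+=\max(0,a)$. $\zeta$ is self-decomposable if $\rho_\zeta(s)=s^{-1}h(s)$ with $h$ decreasing; $\rho_\zeta$ is taken to be differentiable on $(0,\infty)$. Its OU--BDLP $\vartheta$ is the subordinator with $\zeta(1)\stackrel{d}{=}\int_0^\infty e^{-s}\vartheta(ds)$, equivalently $\psi_\vartheta(\omega)=\omega\psi'_\zeta(\omega)$, $\rho_\vartheta(x)=-\rho_\zeta(x)-x\rho'_\zeta(x)$; $v(0)$ denotes a variable with the law of $\int_0^\infty e^{-s}\vartheta(ds)$, the stationary law of the Ornstein–Uhlenbeck process driven by $\vartheta$. The quantile clock with parameters $(U,Z)$ is $T_U(t)=\int_0^t(1-s/t)_+Z(ds)$. *)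

(* Defs.v *)
From HB Require Import structures.
From mathcomp Require Import all_boot all_order all_algebra.
From mathcomp Require Import all_classical all_reals all_analysis.
From mathcomp Require Import measurable_realfun.

Set Implicit Arguments.
Unset Strict Implicit.
Unset Printing Implicit Defensive.

Import Order.TTheory GRing.Theory Num.Theory.
Import numFieldNormedType.Exports.

Local Open Scope classical_set_scope.
Local Open Scope ring_scope.

(* Time is the half-line [0, +oo[: the values at negative times are
   unconstrained and never used. *)
Record increasing_process (R : realType) (d : measure_display)
    (T : measurableType d) := IncreasingProcess {
  ip_val :> R -> T -> R;
  ip_measurable : forall t, 0 <= t -> measurable_fun [set: T] (ip_val t);
  ip_start : forall w, ip_val 0 w = 0;
  ip_nondecreasing :
    forall w s t, 0 <= s -> s <= t -> ip_val s w <= ip_val t w;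
  ip_right_continuous :
    forall w t, 0 <= t -> ip_val s w @[s --> t^'+] --> ip_val t w }.

Section paths.
Context {R : realType} {d : measure_display} {T : measurableType d}.
Variables (X : increasing_process R T) (w : T).

(* [lebesgue_stieltjes_measure] wants a function on the whole line; the path
   is extended by its value 0 at time 0, so that no mass sits on ]-oo, 0]. *)
Definition path_ext (s : R) : R := X (Num.max 0 s) w.

Lemma path_ext_nondecreasing : nondecreasing path_ext.
Proof.
move=> s t st; apply: ip_nondecreasing; first by rewrite le_max lexx.
by rewrite ge_max !le_max lexx /= st orbT.
Qed.

Lemma path_ext_right_continuous : right_continuous path_ext.
Proof.
move=> t; rewrite /path_ext; have [t0|t0] := leP 0 t.
  apply: cvg_trans (@ip_right_continuous _ _ _ X w t t0).
  apply: near_eq_cvg; near=> s.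
  by rewrite (max_idPr _)// (le_trans t0)// ltW//; near: s; exact: nbhs_right_gt.
apply: (@cvg_trans _ (X 0 w @[_ --> t^'+])); last exact: cvg_cst.
apply: near_eq_cvg; near=> s.
by rewrite (max_idPl _)// ltW//; near: s; exact: nbhs_right_lt.
Unshelve. all: by end_near. Qed.

HB.instance Definition _ := isCumulative.Build R _ R path_ext
  path_ext_nondecreasing path_ext_right_continuous.

(* the random measure X(ds) at the outcome w *)
Definition path_measure := lebesgue_stieltjes_measure path_ext.

HB.instance Definition _ := Measure.on path_measure.

End paths.

Definition eq_law (R : realType) (d1 d2 d3 : measure_display)
    (T1 : measurableType d1) (T2 : measurableType d2) (E : measurableType d3)
    (P1 : probability T1 R) (X1 : T1 -> E) (P2 : probability T2 R)
    (X2 : T2 -> E) : Prop :=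
  [/\ measurable_fun [set: T1] X1, measurable_fun [set: T2] X2 &
      forall A, measurable A -> P1 (X1 @^-1` A) = P2 (X2 @^-1` A)].

(* the sigma-algebra generated by (X_t), t >= 0 *)
Definition process_sigma (R : realType) (d : measure_display)
    (T : measurableType d) (X : R -> T -> R) : set (set T) :=
  <<s [set A | exists t B,
         [/\ 0 <= t, measurable B & A = X t @^-1` B]] >>.

Definition independent_processes (R : realType) (d : measure_display)
    (T : measurableType d) (P : probability T R) (X Y : R -> T -> R) : Prop :=
  forall A B, process_sigma X A -> process_sigma Y B ->
    P (A `&` B) = (P A * P B)%E.

Definition stationary_increments (R : realType) (d : measure_display)
    (T : measurableType d) (P : probability T R) (X : R -> T -> R) : Prop :=
  forall s t, 0 <= s -> 0 <= t ->
    eq_law P (fun w => X (s + t) w - X s w) P (fun w => X t w - X 0 w).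

(* Some of the B i may be the full set, so the product rule for the whole
   family covers the subfamilies. *)
Definition independent_increments (R : realType) (d : measure_display)
    (T : measurableType d) (P : probability T R) (X : R -> T -> R) : Prop :=
  forall (n : nat) (t : nat -> R) (B : nat -> set R),
    0 <= t 0%N -> (forall i, t i <= t i.+1) -> (forall i, measurable (B i)) ->
    P (\bigcap_(i < n) [set w | B i (X (t i.+1) w - X (t i) w)]) =
    (\prod_(i < n) P [set w | B i (X (t i.+1) w - X (t i) w)%R])%E.

Definition laplace_exponent (R : realType) (d : measure_display)
    (T : measurableType d) (P : probability T R) (X : T -> R) (u : R) : R :=
  - ln (fine 'E_P[fun w => expR (- (u * X w))]%E).

Definition levy_density (R : realType) (rho : R -> R) : Prop :=
  [/\ measurable_fun (`]0, +oo[ : set R) rho,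
      forall x, 0 < x -> 0 <= rho x &
      (\int[lebesgue_measure]_(x in `]0%R, +oo[) (Num.min 1 x * rho x)%:E
         < +oo)%E].

(* only meaningful for u >= 0, where the integral of a Levy density converges *)
Definition levy_exponent (R : realType) (rho : R -> R) (u : R) : R :=
  \int[lebesgue_measure]_(s in `]0, +oo[) ((1 - expR (- (u * s))) * rho s).

(* The exponent has no linear term in u: the drift is zero. *)
Definition subordinator (R : realType) (d : measure_display)
    (T : measurableType d) (P : probability T R)
    (X : increasing_process R T) (rho : R -> R) : Prop :=
  [/\ stationary_increments P X,
      independent_increments P X,
      levy_density rho &
      forall t u, 0 <= t -> 0 <= u ->
        'E_P[fun w => expR (- (u * X t w))]%E =
        (expR (- (t * levy_exponent rho u)))%:E].

Definition self_decomposable (R : realType) (rho : R -> R) : Prop :=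
  exists h : R -> R,
    (forall x y, 0 < x -> x <= y -> h y <= h x) /\
    (forall s, 0 < s -> rho s = s^-1 * h s).

(* v(0) = int_0^oo exp(- s) theta(ds), a priori extended real-valued *)
Definition OU_stationary (R : realType) (d : measure_display)
    (T : measurableType d) (theta : increasing_process R T) (w : T) : \bar R :=
  (\int[path_measure theta w]_(s in `]0%R, +oo[) (expR (- s))%:E)%E.

Definition OU_BDLP (R : realType) (d : measure_display)
    (T : measurableType d) (P : probability T R)
    (zeta theta : increasing_process R T) : Prop :=
  eq_law P (fun w => (zeta 1 w)%:E) P (OU_stationary theta).

(* X(ds) has no atom at 0, hence integrals over ]0, t]. *)
Definition quantile_clock_U (R : realType) (d : measure_display)
    (T : measurableType d) (Z : increasing_process R T) (t : R) (w : T) : R :=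
  \int[path_measure Z w]_(s in `]0, t]) Num.max 0 (1 - s / t).

Definition short_memory_clock (R : realType) (d : measure_display)
    (T : measurableType d) (Z : increasing_process R T) (eps t : R) (w : T)
    : R :=
  \int[path_measure Z w]_(s in `]0, t])
    Num.min 1 (Num.max 0 (t - s) / eps).

(* Main.v *)
Require Import Defs.
From HB Require Import structures.
From mathcomp Require Import all_boot all_order all_algebra.
From mathcomp Require Import all_classical all_reals all_analysis.
From mathcomp Require Import measurable_realfun.
From mathcomp Require Import ring lra.

Set Implicit Arguments.
Unset Strict Implicit.
Unset Printing Implicit Defensive.

Import Order.TTheory GRing.Theory Num.Theory.
Import numFieldNormedType.Exports.

Local Open Scope classical_set_scope.
Local Open Scope ring_scope.

(** Let rho be the Levy density of zeta, psi its exponent, and psi_Z the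
    exponent of the density - x rho'(x) of Z. Everything rests on the identity
    psi_Z(u) = (u psi(u))' = psi(u) + u psi'(u), proved in integrated form in
    [levy_exponent_average]: the mean of psi_Z over [0, u] is psi(u). It comes
    from Tonelli's theorem and from rho(x) = int_x^oo - rho'(s) ds. As rho is
    only differentiable, with no continuity of rho', the latter is the
    fundamental theorem of calculus for everywhere differentiable monotone
    functions, [FTC2_nondecreasing].

    For a subordinator X with exponent psi_X and a continuous kernel f >= 0,
    the integral of f over ]0, t] against X(ds) has the Laplace exponent
    int_0^t psi_X(u f(s)) ds ([laplace_path_integral], by Riemann sums and
    independent increments). The kernels of the two clocks consist of a linear
    ramp, possibly preceded by a constant piece. By the identity above a ramp
    falling from r to 0 over a time l contributes l psi(u r), and a piece of
    length l where the kernel is 1 contributes l psi_Z(u). With r = 1 and l = t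
    this is the exponent of zeta(t), which settles the quantile clock; for the
    short memory clock it gives (i).

    For the process theta, the kernel exp(- s) on ]0, +oo[ yields
    psi(u) = int_0^oo psi_theta(u exp(- s)) ds, and differentiating
    ([exponent_of_OU_tail]) gives psi_theta(u) = u psi'(u), that is,
    psi_Z = psi + psi_theta. Hence the exponent in (i) is the one of
    zeta(t) + theta(t - eps). Laws on the half-line and Levy densities are
    determined by their exponents, both by [laplace_tail_unique], which turns
    these identities into the equalities of laws, including (ii), and into the
    almost everywhere equality of densities. *)

(** * Integrating the derivative of a monotone function *)

Section differentiable_FTC.
Context {R : realType}.
Implicit Types (F G f g : R -> R) (a b : R).

(** The supremum [s] of the points up to which the inequality holds is itself
    such a point, by continuity of [F]; the local comparison at [s] would carry
    it further if [s] were less than [b]. As [s] is approached from the left, a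
    nondecreasing [G] may jump there. *)
Lemma increment_le_of_local F G a b : a <= b ->
  (forall x, a <= x <= b -> {for x, continuous F}) ->
  (forall x y, a <= x -> x <= y -> y <= b -> G x <= G y) ->
  (forall x, a <= x < b -> exists2 e, 0 < e &
     forall y, x < y -> y < x + e -> y <= b -> F y - F x <= G y - G x) ->
  F b - F a <= G b - G a.
Proof.
move=> ab cF ndG loc.
pose S := [set x | a <= x <= b /\ F x - F a <= G x - G a].
have Sa : S a by rewrite /S/= lexx ab !subrr.
have ubS : ubound S b by move=> x [/andP[]].
have supS : has_sup S by split; [exists a|exists b].
pose s := sup S.
have as_ : a <= s by apply: ub_le_sup => //; exists b.
have sb : s <= b by apply: ge_sup => //; exists a.
have Ss : F s - F a <= G s - G a.
  rewrite leNgt; apply/negP => sgt.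
  set e := (F s - F a) - (G s - G a) in sgt *.
  have e0 : 0 < e by rewrite subr_gt0.
  have /cvgrPdist_lt /(_ _ e0) : {for s, continuous F} by apply: cF; rewrite as_.
  case=> d /= d0 dF.
  have [x Sx sx] := sup_adherent d0 supS.
  have xs : x <= s by apply: ub_le_sup => //; exists b.
  have := dF x; rewrite /ball/= ger0_norm ?subr_ge0//.
  rewrite -/s in sx; move=> /(_ ltac:(lra)).
  case: Sx => /andP[ax xb] FGx; have := ndG _ _ ax xs sb.
  have := ler_norm (F s - F x); rewrite /e; lra.
have [sb'|] := ltP s b; last first.
  by move=> bs; have -> : b = s by apply/eqP; rewrite eq_le bs.
have [|e e0 he] := loc s; first by rewrite as_.
pose y := Num.min b (s + e / 2).
have sy : s < y by rewrite lt_min sb' ltrDl divr_gt0.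
have : S y.
  split; first by rewrite (le_trans as_ (ltW sy)) ge_min lexx.
  have : y < s + e by rewrite gt_min; apply/orP; right; lra.
  move=> /(he _ sy); rewrite ge_min lexx => /(_ isT); lra.
move=> /(ub_le_sup (ex_intro _ b ubS)); rewrite -/s; lra.
Qed.

End differentiable_FTC.

Section majorant.
Context {R : realType}.
Local Notation mu := (@lebesgue_measure R).

(** Half of the Vitali-Caratheodory theorem. Slice [a, b] into the sets [E k]
    where [g] lies in [k h, (k+1) h[, cover each by an open set [U k] of almost
    the same measure, and put the weight (k+1) h on [U k]: openness gives the
    domination near [x], and the integral exceeds that of [g] by [h] times the
    length plus the total error of the covers. *)
Lemma lower_semicontinuous_majorant (g : R -> R) (a b e : R) : a <= b ->
  measurable_fun `[a, b] g -> (forall x, a <= x <= b -> 0 <= g x) -> 0 < e ->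
  exists w : R -> \bar R, [/\ measurable_fun [set: R] w,
    forall x, (0 <= w x)%E,
    forall x, a <= x <= b -> exists2 r, 0 < r &
      forall y, `|x - y| < r -> ((g x)%:E <= w y)%E &
    (\int[mu]_(x in `[a, b]) w x <= \int[mu]_(x in `[a, b]) (g x)%:E + e%:E)%E].
Proof.
move=> ab mg g0 e0; pose D := [set` `[a, b]].
have mD : measurable D by exact: measurable_itv.
have Dg0 x : D x -> 0 <= g x by rewrite /D/= in_itv/=; exact: g0.
have bmD : (mu D = (b - a)%:E)%E.
  rewrite /D lebesgue_measure_itv/= lte_fin; case: ltP => //.
  by move=> ba; congr EFin; lra.
(* half of the error pays for the slices, the other half for the covers; the
   +1 covers the case a = b *)
pose h := e / 2 / (b - a + 1).
have ba1 : 0 < b - a + 1 by lra.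
have h0 : 0 < h by rewrite !divr_gt0.
have hD : h * (b - a) <= e / 2.
  rewrite /h mulrAC ler_pdivrMr// ler_wpM2l//; last by lra.
  by rewrite ltW// divr_gt0.
pose c (k : nat) := k.+1%:R * h.
have c0 k : 0 < c k by rewrite mulr_gt0.
pose E k := D `&` g @^-1` `[k%:R * h, k.+1%:R * h[.
have mE k : measurable (E k) by apply: mg => //.
have EDk k : E k `<=` D by move=> x [].
have DE : D = \bigcup_k E k.
  apply/seteqP; split => [x Dx|x [k _ /EDk]//].
  exists (Num.truncn (g x / h)) => //; split => //=.
  have := Dx; rewrite /D /= in_itv/= => /g0 gx.
  have := truncn_itv (divr_ge0 gx (ltW h0)); rewrite in_itv/=.
  by rewrite ler_pdivlMr// ltr_pdivrMr.
have tE : trivIset setT E.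
  suff kE k x : E k x -> k = Num.truncn (g x / h).
    by move=> i j _ _ [x [/kE -> /kE ->]].
  case=> _; rewrite /= in_itv/= => /andP[kg gk]; apply/esym/truncn_def.
  by rewrite ler_pdivlMr// ltr_pdivrMr// kg gk.
have /choice [U HU] : forall k, exists U : set R, [/\ open U, E k `<=` U &
    (mu (U `\` E k) < ((e / 2 / (2 ^ k.+1)%:R) / c k)%:E)%E].
  move=> k; apply: lebesgue_regularity_outer => //.
    apply: (@le_lt_trans _ _ (mu D)); last by rewrite bmD ltry.
    by apply: le_measure; rewrite ?inE; [exact: mE|exact: mD|exact: EDk].
  by rewrite !divr_gt0// ltr0n expn_gt0.
have mU k : measurable (U k) by apply: open_measurable; case: (HU k).
pose w x : \bar R := (\sum_(0 <= k <oo) ((c k)%:E * (\1_(U k) x)%:E))%E.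
have t0 k x : (0 <= ((c k)%:E * (\1_(U k) x)%:E))%E.
  by rewrite mule_ge0// lee_fin ltW.
have mt k : measurable_fun [set: R] (fun x => (c k)%:E * (\1_(U k) x)%:E)%E.
  by apply: measurable_funeM; exact/measurable_EFinP/measurable_indic.
have mw : measurable_fun [set: R] w.
  by apply: (@ge0_emeasurable_sum _ _ _ _ _ predT) => // k _; exact: mt.
exists w; split => //.
- by move=> x; apply: nneseries_ge0 => k _ _; exact: t0.
- move=> x abx.
  have : D x by rewrite /D/= in_itv.
  rewrite DE => -[k _ Ekx].
  have [oU EU _] := HU k.
  have /open_nbhs_nbhs : open_nbhs x (U k) by split => //; exact: EU.
  case=> r /= r0 xrU; exists r => // y xy.
  have Uy : U k y by exact: xrU.
  apply: (@le_trans _ _ ((c k)%:E * (\1_(U k) y)%:E)%E).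
    rewrite indicE mem_set// mule1 lee_fin; apply: ltW.
    by case: Ekx => _ /=; rewrite in_itv/= => /andP[].
  apply: le_trans (nneseries_lim_ge k.+1 _); last by move=> *; exact: t0.
  by rewrite big_nat_recr//= leeDr// sume_ge0.
have -> : (\int[mu]_(x in D) w x =
    \sum_(0 <= k <oo) \int[mu]_(x in D) ((c k)%:E * (\1_(U k) x)%:E))%E.
  apply: integral_nneseries; first exact: mD.
    by move=> k; apply: measurable_funTS; exact: mt.
  by move=> *; exact: t0.
have intgh : (\int[mu]_(x in D) (g x + h)%:E <=
    \int[mu]_(x in D) (g x)%:E + (e / 2)%:E)%E.
  have -> : (\int[mu]_(x in D) (g x + h)%:E =
      \int[mu]_(x in D) (g x)%:E + \int[mu]_(x in D) h%:E)%E.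
    under eq_integral do rewrite EFinD.
    apply: ge0_integralD; first exact: mD.
    - by move=> x /Dg0.
    - exact/measurable_EFinP.
    - by move=> x _; rewrite lee_fin ltW.
    - exact: measurable_cst.
  by rewrite leeD2l// integral_cst// [X in (_ * X)%E]bmD -EFinM lee_fin.
apply: (@le_trans _ _ (\int[mu]_(x in D) (g x + h)%:E + (e / 2)%:E)%E); last first.
  by rewrite (le_trans (leeD2r _ intgh))// -addeA -EFinD -splitr.
rewrite [X in (_ <= X + _)%E](_ : _ = (\sum_(0 <= k <oo)
    \int[mu]_(x in E k) (g x + h)%:E)%E); last first.
  rewrite [in LHS]DE ge0_integral_bigcup// -DE.
    by apply/measurable_EFinP/measurable_funD.
  by move=> x /Dg0 ?; rewrite lee_fin addr_ge0// ltW.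
have iE0 k : (0 <= \int[mu]_(x in E k) (g x + h)%:E)%E.
  by apply: integral_ge0 => x /EDk /Dg0 ?; rewrite lee_fin addr_ge0// ltW.
apply: le_trans (epsilon_trick xpredT iE0 (ltW _)); last by rewrite divr_gt0.
apply: lee_nneseries => [k _ _|k _]; first exact: integral_ge0.
have -> : (\int[mu]_(x in D) ((c k)%:E * (\1_(U k) x)%:E) =
    (c k)%:E * mu (U k `&` D))%E.
  rewrite -(@integral_indic _ _ _ mu D mD (U k) (mU k)).
  apply: ge0_integralZl_EFin; [exact: mD| | |exact/ltW].
    by move=> x _; rewrite lee_fin.
  by apply/measurable_EFinP; apply: measurable_indic; exact: mU.
have [_ EU UE] := HU k.
apply: (@le_trans _ _ ((c k)%:E * (mu (E k) + mu (U k `\` E k)))%E).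
  apply: lee_wpmul2l; first by rewrite lee_fin ltW.
  apply: (@le_trans _ _ (mu (E k `|` (U k `\` E k)))%E); last first.
    by apply: measureU2; [exact: mE|apply: measurableD; [exact: mU|exact: mE]].
  apply: le_measure; rewrite ?inE.
  - by apply: measurableI; [exact: mU|exact: mD].
  - by apply: measurableU; [exact: mE|apply: measurableD; [exact: mU|exact: mE]].
  - by move=> x [Ux _]; have [?|?] := pselect (E k x); [left|right].
rewrite ge0_muleDr//; apply: leeD.
  have <- : (\int[mu]_(x in E k) (c k)%:E = (c k)%:E * mu (E k))%E.
    by rewrite integral_cst//; exact: mE.
  apply: ge0_le_integral => /=.
  - exact: mE.
  - by move=> x _; rewrite lee_fin ltW.
  - exact: measurable_cst.
  - apply/measurable_EFinP/measurable_funD; last exact: measurable_cst.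
    exact: measurable_funS (EDk k) mg.
  - move=> x [_ /=]; rewrite in_itv/= lee_fin /c => /andP[+ _].
    by rewrite -natr1 mulrDl mul1r lerD2r.
apply: (le_trans (lee_wpmul2l _ (ltW UE))); first by rewrite lee_fin ltW.
by rewrite -EFinM lee_fin mulrC divfK// gt_eqF.
Qed.

End majorant.

Section dini_bound.
Context {R : realType}.
Local Notation mu := (@lebesgue_measure R).

(** A bound on the upper right Dini derivative integrates. If [w] dominates [g]
    near every point, then G(y) = int_a^y w + h y grows locally at least as fast
    as [F], so [increment_le_of_local] applies to [F] and [G]. *)
Lemma increment_le_integral (F g : R -> R) (a b : R) : a <= b ->
  (forall x, a <= x <= b -> {for x, continuous F}) ->
  measurable_fun `[a, b] g -> (forall x, a <= x <= b -> 0 <= g x) ->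
  (forall x e, a <= x < b -> 0 < e -> exists2 d, 0 < d &
     forall y, x < y -> y < x + d -> F y - F x <= (g x + e) * (y - x)) ->
  ((F b - F a)%:E <= \int[mu]_(x in `[a, b]) (g x)%:E)%E.
Proof.
move=> ab cF mg g0 diniF.
have int0 : (0 <= \int[mu]_(x in `[a, b]) (g x)%:E)%E.
  by apply: integral_ge0 => x /=; rewrite in_itv/= lee_fin => /g0.
have [->|intlty] := eqVneq (\int[mu]_(x in `[a, b]) (g x)%:E)%E +oo%E.
  by rewrite leey.
have {}intlty : (\int[mu]_(x in `[a, b]) (g x)%:E < +oo)%E by rewrite ltey.
apply/lee_addgt0Pr => e e0.
have e20 : 0 < e / 2 by rewrite divr_gt0.
have [w [mw w0 gw wint]] := lower_semicontinuous_majorant ab mg g0 e20.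
pose h := e / 2 / (b - a + 1).
have ba1 : 0 < b - a + 1 by lra.
have h0 : 0 < h by rewrite divr_gt0.
have hD : h * (b - a) <= e / 2.
  rewrite /h mulrAC ler_pdivrMr// ler_wpM2l//; last by lra.
  by rewrite ltW.
pose W y := (\int[mu]_(x in `[a, y]) w x)%E.
have Wlty y : y <= b -> (W y < +oo)%E.
  move=> yb; apply: (@le_lt_trans _ _ (W b)).
    apply: ge0_subset_integral => //=.
    - exact: measurable_funTS.
    - by move=> x /=; rewrite !in_itv/= => /andP[-> xy]; exact: le_trans yb.
  by apply: (le_lt_trans wint); rewrite lte_add_pinfty// ltry.
have W0 y : (0 <= W y)%E by apply: integral_ge0.
have Wfin y : y <= b -> W y \is a fin_num by move=> yb; rewrite ge0_fin_numE ?Wlty.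
have WB m x y : a <= x -> x <= y -> y <= b -> 0 <= m ->
    (forall z, x <= z <= y -> (m%:E <= w z)%E) ->
    m * (y - x) <= fine (W y) - fine (W x).
  move=> ax xy yb m0 mwz.
  have WE : (W y = W x + \int[mu]_(z in `]x, y]) w z)%E.
    rewrite /W -ge0_integral_setU//=.
    - congr (integral _ _ _).
      by rewrite -(@itv_bndbnd_setU _ _ (BLeft a) (BRight x) (BRight y)).
    - exact: measurable_funTS.
    - by apply/disj_set2P/seteqP; split => // z [/=]; rewrite !in_itv/=; lra.
  have : ((m * (y - x))%:E <= \int[mu]_(z in `]x, y]) w z)%E.
    have <- : (\int[mu]_(z in `]x, y]) m%:E = (m * (y - x))%:E)%E.
      rewrite integral_cst//= lebesgue_measure_itv/= lte_fin.
      case: ltP => xy'; first by rewrite -EFinD -EFinM.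
      by have -> : y - x = 0 by lra; rewrite mulr0 mule0.
    apply: ge0_le_integral => //=.
    - exact: measurable_funTS.
    - by move=> z; rewrite in_itv/= => /andP[xz zy]; apply: mwz; rewrite (ltW xz).
  rewrite lerBrDl -lee_fin EFinD fineK ?Wfin ?(le_trans xy)//.
  by rewrite (fineK (Wfin _ yb)) WE; exact: leeD2l.
pose G y := fine (W y) + h * y.
have : F b - F a <= G b - G a.
  apply: increment_le_of_local => //.
  - move=> x y ax xy yb; rewrite /G lerD//; last by rewrite ler_wpM2l// ltW.
    by rewrite -subr_ge0 -(mul0r (y - x)); apply: WB.
  - move=> x /[dup] axb /andP[ax xb].
    have [d1 d10 Fd1] := diniF x h axb h0.
    have [|d2 d20 wd2] := gw x; first by rewrite ax ltW.
    exists (Num.min d1 d2); first by rewrite lt_min d10.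
    move=> y xy yxd yb.
    have [yd1 yd2] : y < x + d1 /\ y < x + d2.
      by move: yxd; rewrite -!ltrBlDl lt_min => /andP[].
    apply: (le_trans (Fd1 y xy yd1)).
    have : g x * (y - x) <= fine (W y) - fine (W x).
      apply: WB => //; [exact: ltW|by apply: g0; rewrite ax ltW|].
      move=> z /andP[xz zy]; apply: wd2; rewrite ler0_norm; lra.
    by rewrite /G; lra.
rewrite -lee_fin => /le_trans; apply.
have -> : G b - G a = fine (W b) - fine (W a) + h * (b - a) by rewrite /G; ring.
apply: (@le_trans _ _ (fine (W b) + e / 2)%:E).
  by rewrite lee_fin lerD// gerBl fine_ge0.
rewrite EFinD fineK ?Wfin//.
by rewrite (le_trans (leeD2r _ wint))// -addeA -EFinD -splitr.
Qed.

End dini_bound.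

Section FTC.
Context {R : realType}.
Local Notation mu := (@lebesgue_measure R).

Lemma derivable_increment (f : R -> R) (x e : R) : derivable f x 1 -> 0 < e ->
  exists2 d, 0 < d & forall y, x < y -> y < x + d ->
    `|(f y - f x) - derive1 f x * (y - x)| <= e * (y - x).
Proof.
move=> df e0; have : h^-1 *: (f (h *: (1:R) + x) - f x) @[h --> 0^'] --> derive1 f x.
  by rewrite derive1E; exact: df.
move=> /cvgrPdist_lt /(_ _ e0) [d /= d0 dP]; exists d => // y xy yxd.
have yx0 : 0 < y - x by rewrite subr_gt0.
have := dP (y - x); rewrite /ball_ /= sub0r normrN gtr0_norm//.
move=> /(_ ltac:(lra)) /(_ (lt0r_neq0 yx0)).
rewrite /GRing.scale/= mulr1 subrK distrC => fe.
have -> : (f y - f x) - derive1 f x * (y - x) =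
  ((y - x)^-1 * (f y - f x) - derive1 f x) * (y - x).
  by rewrite mulrBl mulrAC mulVf ?mul1r// gt_eqF.
by rewrite normrM (gtr0_norm yx0) ler_pM2r// ltW.
Qed.

(** The derivative may be discontinuous everywhere and unbounded, so that
    neither Riemann integration nor domination is available. The Dini bound
    gives one inequality for [f] itself. For the other one apply it to
    M x - f(x), whose derivative is at most M - min(M, f'), and let M tend to
    infinity by monotone convergence. *)
Lemma FTC2_nondecreasing (f : R -> R) (a b : R) : a <= b ->
  (forall x, a <= x <= b -> derivable f x 1) ->
  measurable_fun `[a, b] (derive1 f) ->
  (forall x, a <= x <= b -> 0 <= derive1 f x) ->
  (\int[mu]_(x in `[a, b]) (derive1 f x)%:E = (f b - f a)%:E)%E.
Proof.
move=> ab df mf' f'0.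
have cf x : a <= x <= b -> {for x, continuous f}.
  by move=> /df /derivable1_diffP /differentiable_continuous.
apply/eqP; rewrite eq_le; apply/andP; split; last first.
  apply: increment_le_integral => // x e axb e0.
  have [|d d0 fd] := @derivable_increment f x e _ e0.
    by apply: df; move: axb; lra.
  exists d => // y xy yxd; have := fd y xy yxd.
  by have := ler_norm (f y - f x - derive1 f x * (y - x)); lra.
pose m (n : nat) x := Num.min n%:R (derive1 f x).
have m0 n x : a <= x <= b -> 0 <= m n x by move=> /f'0 ?; rewrite le_min ler0n.
have mm n : measurable_fun `[a, b] (m n) by apply: measurable_minr.
have lim_m x : m n x @[n --> \oo] --> derive1 f x.
  apply: cvg_near_cst; near=> n; apply/min_idPr.
  by near: n; exact: nbhs_infty_ger.
have -> : (\int[mu]_(x in `[a, b]) (derive1 f x)%:E =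
           \int[mu]_(x in `[a, b]) limn (fun n => (m n x)%:E))%E.
  apply: eq_integral => x _; apply/esym/cvg_lim => //.
  by apply: cvg_EFin; [exact: nearW|exact: lim_m].
apply: (@cvge_le _ \oo _ _ (fun n => \int[mu]_(x in `[a, b]) (m n x)%:E)%E); last first.
- apply: cvg_monotone_convergence => //.
  + by move=> n; apply/measurable_EFinP; exact: mm.
  + move=> x _ n k nk; rewrite lee_fin /m le_min !ge_min lexx orbT andbT.
    by rewrite ler_nat nk.
- apply: nearW => n.
  have n0 : (0:R) <= n%:R by [].
  have int_n : (\int[mu]_(x in `[a, b]) (n%:R)%:E = (n%:R * (b - a))%:E)%E.
    rewrite integral_cst//= lebesgue_measure_itv/= lte_fin.
    case: ltP => xy'; first by rewrite -EFinD -EFinM.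
    by have -> : b - a = 0 by lra; rewrite mulr0 mule0.
  have mle x : m n x <= n%:R by rewrite ge_min lexx.
  have mn : measurable_fun `[a, b] (fun x => n%:R - m n x).
    by apply: measurable_funB.
  have n0m x : a <= x <= b -> 0 <= n%:R - m n x by rewrite subr_ge0.
  have : (((n%:R * b - f b) - (n%:R * a - f a))%:E <=
      \int[mu]_(x in `[a, b]) (n%:R - m n x)%:E)%E.
    apply: (@increment_le_integral _ (fun x => n%:R * x - f x)) => //.
    + move=> x axb; apply: cvgB; last exact: cf.
      by apply: cvgMr; exact: cvg_id.
    + move=> x e axb e0.
      have [|d d0 fd] := @derivable_increment f x e _ e0.
        by apply: df; move: axb; lra.
      exists d => // y xy yxd; have := fd y xy yxd.
      rewrite ler_norml => /andP[+ _].
      have : m n x * (y - x) <= derive1 f x * (y - x).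
        apply: ler_wpM2r; first by rewrite subr_ge0 ltW.
        by rewrite ge_min lexx orbT.
      lra.
  have splitn : (\int[mu]_(x in `[a, b]) (n%:R)%:E =
      \int[mu]_(x in `[a, b]) (m n x)%:E +
      \int[mu]_(x in `[a, b]) (n%:R - m n x)%:E)%E.
    rewrite -ge0_integralD//.
    + by apply: eq_integral => x _; rewrite -EFinD addrC subrK.
    + by move=> x xab; rewrite lee_fin; apply: m0; move: xab; rewrite /= in_itv.
    + by apply/measurable_EFinP; exact: mm.
    + by apply/measurable_EFinP; exact: mn.
  have i0 : (0 <= \int[mu]_(x in `[a, b]) (m n x)%:E)%E.
    by apply: integral_ge0 => x /=; rewrite in_itv/= lee_fin; exact: m0.
  have j0 : (0 <= \int[mu]_(x in `[a, b]) (n%:R - m n x)%:E)%E.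
    by apply: integral_ge0 => x /=; rewrite in_itv/= lee_fin; exact: n0m.
  move: splitn i0 j0; rewrite int_n.
  case: (\int[mu]_(x in `[a, b]) (m n x)%:E)%E => [r| |];
  case: (\int[mu]_(x in `[a, b]) (n%:R - m n x)%:E)%E => [s| |] //=.
  by move=> [rs] _ _; rewrite !lee_fin; lra.
Unshelve. all: by end_near. Qed.

End FTC.

(** * Averaging the Levy exponent of the driving process *)

Lemma measurable_expRNM (R : realType) d (T : measurableType d) (D : set T)
    (f g : T -> R) : measurable_fun D f -> measurable_fun D g ->
  measurable_fun D (fun x => expR (- (f x * g x))).
Proof.
move=> mf mg; apply: (measurableT_comp (@measurable_expR R)).
by apply: measurableT_comp => //; exact: measurable_funM.
Qed.

Lemma tonelli_on (R : realType) d1 d2 (T1 : measurableType d1)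
    (T2 : measurableType d2) (m1 : {sigma_finite_measure set T1 -> \bar R})
    (m2 : {sigma_finite_measure set T2 -> \bar R}) (A : set T1) (B : set T2)
    (f : T1 -> T2 -> R) :
  measurable A -> measurable B ->
  measurable_fun (A `*` B) (fun z => f z.1 z.2) ->
  (forall x y, A x -> B y -> 0 <= f x y) ->
  (\int[m1]_(x in A) \int[m2]_(y in B) (f x y)%:E =
   \int[m2]_(y in B) \int[m1]_(x in A) (f x y)%:E)%E.
Proof.
move=> mA mB mf f0.
pose F := (fun z : T1 * T2 => (f z.1 z.2)%:E) \_ (A `*` B).
have mF : measurable_fun [set: T1 * T2] F.
  apply/(@measurable_restrictT _ _ _ _ (A `*` B)); first exact: measurableX.
  exact/measurable_EFinP.
have F0 z : (0 <= F z)%E.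
  by apply: erestrict_ge0 => -[x y] [/= Ax By]; rewrite lee_fin; exact: f0.
have FE x y : F (x, y) =
    if (x \in A) && (y \in B) then (f x y)%:E else 0%E.
  by rewrite /F /patch in_setX.
transitivity (\int[m1]_x \int[m2]_y F (x, y))%E.
  rewrite [LHS]integral_mkcond; apply: eq_integral => x _; rewrite /patch.
  have [xA|xA] := boolP (x \in A).
    rewrite integral_mkcond; apply: eq_integral => y _.
    by rewrite /patch FE xA.
  by rewrite integral0_eq// => y _; rewrite FE (negbTE xA).
transitivity (\int[m2]_y \int[m1]_x F (x, y))%E; first exact: fubini_tonelli.
rewrite [RHS]integral_mkcond; apply: eq_integral => y _; rewrite /patch.
have [yB|yB] := boolP (y \in B).
  rewrite [RHS]integral_mkcond; apply: eq_integral => x _.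
  by rewrite /patch FE yB andbT.
by rewrite integral0_eq// => x _; rewrite FE (negbTE yB) andbF.
Qed.

Section defect.
Context {R : realType}.
Local Notation mu := (@lebesgue_measure R).

(** The right-hand side is symmetric in [c] and [b]: this is what lets the same
    kernel be read as an integral over frequencies or over jump sizes in
    [levy_exponent_average]. *)
Lemma integral_expR_defect (c b : R) : 0 <= c -> 0 <= b ->
  (\int[mu]_(x in `[0%R, b]) (c * (1 - expR (- (c * x))))%:E =
   (c * b - 1 + expR (- (c * b)))%:E)%E.
Proof.
move=> c0 b0.
pose F x := c * x + expR (- (c * x)).
have dF x : is_derive x (1 : R) F (c * (1 - expR (- (c * x)))).
  apply: is_derive_eq; rewrite /GRing.scale/=; ring.
have F'E x : derive1 F x = c * (1 - expR (- (c * x))).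
  by rewrite derive1E; apply: derive_val.
under eq_integral do rewrite -F'E.
rewrite FTC2_nondecreasing//.
- by rewrite /F !mulr0 oppr0 expR0; congr EFin; ring.
- apply: (eq_measurable_fun (fun x => c * (1 - expR (- (c * x))))).
    by move=> x _; rewrite F'E.
  apply: measurable_funM => //; apply: measurable_funB => //.
  exact: measurable_expRNM.
- move=> x /andP[x0 _]; rewrite F'E mulr_ge0// subr_ge0 -expR0 ler_expR.
  by rewrite oppr_le0 mulr_ge0.
Qed.

End defect.

Section levy_density_identity.
Context {R : realType}.
Local Notation mu := (@lebesgue_measure R).
Local Notation pos := [set` (`]0%R, +oo[ : interval R)].
Variable rho : R -> R.
Hypothesis sd : self_decomposable rho.
Hypothesis drho : forall x, 0 < x -> derivable rho x 1.
Hypothesis Lrho : levy_density rho.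
Hypothesis LZ : levy_density (fun x => - (x * derive1 rho x)).

Let q (x : R) : R := - derive1 rho x.

Let q_ge0 x : 0 < x -> 0 <= q x.
Proof.
move=> x0; case: LZ => _ /(_ x x0) + _.
by rewrite -mulrN pmulr_rge0.
Qed.

Let mq : measurable_fun pos q.
Proof.
case: LZ => mZ _ _.
apply: (eq_measurable_fun (fun x : R => x^-1 * - (x * derive1 rho x) : R)).
  move=> x; rewrite inE/= in_itv/= andbT => x0.
  by rewrite -mulrN mulrA mulVf ?mul1r// gt_eqF.
apply: measurable_funM => //.
apply: open_continuous_measurable_fun => //.
move=> x; rewrite inE/= in_itv/= andbT => x0.
by apply: inv_continuous; rewrite gt_eqF.
Qed.

Let rho_infty : rho x @[x --> +oo] --> (0 : R).
Proof.
have [h [hd hE]] := sd.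
apply: (@squeeze_cvgr _ _ _ _ (fun=> 0) (fun x => x^-1 * h 1)).
- near=> x.
  have x1 : 1 <= x by near: x; exact: nbhs_pinfty_ge.
  have x0 : 0 < x by exact: lt_le_trans x1.
  case: Lrho => _ -> // _; rewrite hE// ler_wpM2l ?invr_ge0 ?(ltW x0)//.
  exact: hd.
- exact: cvg_cst.
- rewrite -(mul0r (h 1)); apply: cvgMl.
  have x0 : \forall x \near +oo, 0 < (id x : R) by exact: nbhs_pinfty_gt.
  by apply/(gtr0_cvgV0 x0); exact: cvg_id.
Unshelve. all: by end_near. Qed.

(** The density tends to 0 at infinity because s * rho(s) is nonincreasing. *)
Lemma integral_tail_derive (x : R) : 0 < x ->
  (\int[mu]_(s in `[x, +oo[) (- derive1 rho s)%:E = (rho x)%:E)%E.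
Proof.
move=> x0.
pose J (n : nat) := (\int[mu]_(s in `[x, (x + n%:R)%R]) (q s)%:E)%E.
have I : J = (fun n => (rho x - rho (x + n%:R))%:E).
  apply/funext => n.
  have ds s : x <= s <= x + n%:R -> derive1 (- rho) s = q s.
    by move=> /andP[xs _]; rewrite derive1N//; apply: drho; exact: lt_le_trans xs.
  transitivity (\int[mu]_(s in `[x, (x + n%:R)%R]) (derive1 (- rho) s)%:E)%E.
    by apply: eq_integral => s; rewrite inE/= in_itv/= => /ds ->.
  rewrite FTC2_nondecreasing ?lerDl//.
  - by congr EFin; rewrite !fctE opprK addrC.
  - move=> s /andP[xs _]; apply: derivableN; apply: drho; exact: lt_le_trans xs.
  - apply: (eq_measurable_fun q).
      by move=> s; rewrite inE/= in_itv/= => /ds ->.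
    apply: measurable_funS mq => //.
    by move=> s /=; rewrite !in_itv/= andbT => /andP[xs _]; exact: lt_le_trans xs.
  - by move=> s /[dup] /ds -> /andP[xs _]; apply: q_ge0; exact: lt_le_trans xs.
have c1 : (J n @[n --> \oo] --> \int[mu]_(s in `[x, +oo[) (q s)%:E)%E.
  rewrite itv_bndy_bigcup_BRight; apply: ge0_nondecreasing_set_cvg_integral.
  - move=> n k nk; apply/subsetPset => s /=; rewrite !in_itv/= => /andP[-> /=].
    by move=> /le_trans; apply; rewrite lerD2l ler_nat.
  - by [].
  - move=> n; apply/measurable_EFinP; apply: measurable_funS mq => //.
    by move=> s /=; rewrite !in_itv/= andbT => /andP[xs _]; exact: lt_le_trans xs.
  - move=> n s /=; rewrite in_itv/= lee_fin => /andP[xs _].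
    by apply: q_ge0; exact: lt_le_trans xs.
apply: (cvg_unique _ c1) => //.
rewrite I.
apply: cvg_EFin; first exact: nearW.
rewrite -[X in _ --> X]subr0; apply: cvgB; first exact: cvg_cst.
apply: (cvg_comp (fun n => x + n%:R) rho _ rho_infty).
exact: (cvg_comp (fun n => n%:R) (fun r => x + r) cvgr_idn (cvg_addrl x)).
Qed.

(** This is the identity psi_Z = (u psi(u))', in integrated form. By
    [integral_expR_defect] both sides are the integral of - rho'(s) against the
    kernel s u - 1 + exp(- s u): the left one after integrating over the
    frequency [v] in [0, u], the right one after writing rho(x) as the integral
    of - rho' over [x, +oo[. All integrands are nonnegative. *)
Lemma levy_exponent_average (u : R) : 0 <= u ->
  (\int[mu]_(v in `[0%R, u])
     \int[mu]_(s in pos) ((1 - expR (- (v * s))) * - (s * derive1 rho s))%:E =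
  u%:E * \int[mu]_(s in pos) ((1 - expR (- (u * s))) * rho s)%:E)%E.
Proof.
move=> u0.
pose A : set R := [set` `[0, u]].
have mA : measurable A by exact: measurable_itv.
have mpos : measurable pos by exact: measurable_itv.
have posE x : pos x -> 0 < x by rewrite /= in_itv/= andbT.
have AE v : A v -> 0 <= v by rewrite /A/= in_itv/= => /andP[].
have def_ge0 c x : 0 <= c -> 0 <= x -> 0 <= c * (1 - expR (- (c * x))).
  move=> c0 x0; rewrite mulr_ge0// subr_ge0 -expR0 ler_expR.
  by rewrite oppr_le0 mulr_ge0.
have mfst (B C : set R) : measurable_fun (B `*` C) (@fst R R).
  by apply: measurable_funTS; exact: measurable_fst.
have msnd (B C : set R) : measurable_fun (B `*` C) (@snd R R).
  by apply: measurable_funTS; exact: measurable_snd.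
have mdef (D : set (R * R)) (f g : R * R -> R) : measurable_fun D f ->
    measurable_fun D g ->
    measurable_fun D (fun z => f z * (1 - expR (- (f z * g z)))).
  move=> mf mg; apply: measurable_funM => //; apply: measurable_funB => //.
  exact: measurable_expRNM.
transitivity (\int[mu]_(s in pos) (q s * (s * u - 1 + expR (- (s * u))))%:E)%E.
  transitivity (\int[mu]_(v in A) \int[mu]_(s in pos)
      (q s * (s * (1 - expR (- (s * v)))))%:E)%E.
    apply: eq_integral => v _; apply: eq_integral => s _.
    by congr EFin; rewrite /q (mulrC v); ring.
  rewrite (@tonelli_on _ _ _ _ _ mu mu _ _
    (fun v s => q s * (s * (1 - expR (- (s * v))))))//.
  - apply: eq_integral => s; rewrite inE => /posE s0.
    under eq_integral do rewrite EFinM.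
    rewrite ge0_integralZl_EFin ?q_ge0//.
    + by rewrite integral_expR_defect ?(ltW s0)// -EFinM.
    + by move=> v /AE v0; rewrite lee_fin def_ge0// ltW.
    + apply/measurable_EFinP; apply: measurable_funM => //.
      by apply: measurable_funB => //; exact: measurable_expRNM.
  - apply: measurable_funM; last exact: mdef.
    apply: (measurable_comp mpos _ mq (msnd A pos)).
    by move=> _ [[v s] [_ /= sp] <-].
  - by move=> v s /AE v0 /posE s0; rewrite mulr_ge0 ?q_ge0// def_ge0// ltW.
pose K s x := (u * (1 - expR (- (u * x)))) * (if x <= s then q s else 0).
have qif_ge0 s x : 0 < s -> 0 <= (if x <= s then q s else 0).
  by case: ifP => // _ /q_ge0.
transitivity (\int[mu]_(s in pos) \int[mu]_(x in pos) (K s x)%:E)%E.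
  apply: eq_integral => s; rewrite inE => /posE s0.
  have -> : (\int[mu]_(x in pos) (K s x)%:E = \int[mu]_(x in `]0%R, s])
      (q s * (u * (1 - expR (- (u * x)))))%:E)%E.
    have -> : [set` `]0%R, s]] = pos `&` [set` `]-oo, s]].
      by apply/seteqP; split => x /=; rewrite !in_itv/= andbT => /andP.
    rewrite integral_mkcondr; apply: eq_integral => x _; rewrite /patch /K.
    have -> : (x \in [set` `]-oo, s]]) = (x <= s).
      by apply/idP/idP; rewrite inE/= in_itv.
    by case: ifP => _; rewrite ?mulr0// mulrC.
  have mdu : measurable_fun [set: R] (fun x => u * (1 - expR (- (u * x)))).
    apply: measurable_funM => //; apply: measurable_funB => //.
    exact: measurable_expRNM.
  rewrite integral_itv_obnd_cbnd; last first.
    by apply/measurable_EFinP/measurable_funM => //; exact: measurable_funTS.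
  under eq_integral do rewrite EFinM.
  rewrite ge0_integralZl_EFin ?q_ge0//.
  - by rewrite integral_expR_defect ?(ltW s0)// -EFinM (mulrC u s).
  - by move=> x /=; rewrite in_itv/= lee_fin => /andP[x0 _]; rewrite def_ge0.
  - by apply/measurable_EFinP; exact: measurable_funTS.
rewrite (@tonelli_on _ _ _ _ _ mu mu _ _ K)//; last 2 first.
- apply: measurable_funM.
    by apply: (mdef _ (fun=> u) snd) => //; exact: msnd.
  apply: measurable_fun_if.
  + exact: measurableX.
  + by apply: measurable_fun_ler; [exact: msnd|exact: mfst].
  + apply: (@measurable_funS _ _ _ _ (pos `*` pos)).
    * exact: measurableX.
    * by move=> z [].
    * apply: (measurable_comp mpos _ mq (mfst pos pos)).
      by move=> _ [[s x] [/= sp _] <-].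
  + exact: measurable_cst.
- move=> s x ps px; have s0 := posE _ ps; have x0 := posE _ px.
  by rewrite mulr_ge0 ?qif_ge0// def_ge0// ltW.
transitivity (\int[mu]_(x in pos)
    ((u * (1 - expR (- (u * x))))%:E * (rho x)%:E))%E; last first.
  rewrite -ge0_integralZl_EFin//.
  - by apply: eq_integral => x _; rewrite -!EFinM mulrA.
  - move=> x /posE x0; rewrite lee_fin mulr_ge0//; last by case: Lrho => _ + _; apply.
    by rewrite subr_ge0 -expR0 ler_expR oppr_le0 mulr_ge0// ltW.
  - apply/measurable_EFinP; apply: measurable_funM; last by case: Lrho.
    by apply: measurable_funB => //; exact: measurable_expRNM.
apply: eq_integral => x; rewrite inE => /posE x0.
rewrite -(integral_tail_derive x0).
have -> : (\int[mu]_(s in `[x, +oo[) (q s)%:E =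
    \int[mu]_(s in pos) (if x <= s then q s else 0)%:E)%E.
  have -> : [set` `[x, +oo[] = pos `&` [set` `[x, +oo[].
    apply/seteqP; split => s /=; rewrite !in_itv/= !andbT; last by case.
    by move=> xs; split => //; exact: lt_le_trans xs.
  rewrite integral_mkcondr; apply: eq_integral => s _; rewrite /patch.
  have -> : (s \in [set` `[x, +oo[]) = (x <= s).
    by apply/idP/idP; rewrite inE/= in_itv/= andbT.
  by case: ifP.
rewrite -ge0_integralZl_EFin//.
- by move=> s /posE s0; rewrite lee_fin qif_ge0.
- apply/measurable_EFinP; apply: measurable_fun_if => //.
  + exact: measurable_fun_ler.
  + by apply: measurable_funS mq => //; exact: subIsetl.
- by rewrite def_ge0// ltW.
Qed.

End levy_density_identity.

(** * Levy exponents as functions of the frequency *)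

(** Continued by the value psi(0) = 0 to the left of 0, where the defining
    integral may diverge, the exponent is continuous on the whole line. *)
Definition levy_exponent_ext (R : realType) (rho : R -> R) (u : R) : R :=
  levy_exponent rho (Num.max 0 u).

Section levy_exponent_continuity.
Context {R : realType}.
Local Notation mu := (@lebesgue_measure R).
Local Notation pos := [set` (`]0%R, +oo[ : interval R)].
Variable rho : R -> R.
Hypothesis Lrho : levy_density rho.

Lemma defect_ge0 (y : R) : 0 <= y -> 0 <= 1 - expR (- y).
Proof. by move=> y0; rewrite subr_ge0 -expR0 ler_expR oppr_le0. Qed.

Lemma defect_le (u s : R) : 0 <= u -> 0 < s ->
  1 - expR (- (u * s)) <= (1 + u) * Num.min 1 s.
Proof.
move=> u0 s0; have /ltW e0 := expR_gt0 (- (u * s)).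
have e1 := expR_ge1Dx (- (u * s)).
have := leP 1 s; case=> s1; first by rewrite mulr1; lra.
have : 0 <= u * s by rewrite mulr_ge0// ltW.
rewrite mulrDl mul1r; lra.
Qed.

Lemma levy_defect_ge0 (u s : R) : 0 <= u -> pos s ->
  0 <= (1 - expR (- (u * s))) * rho s.
Proof.
move=> u0; rewrite /= in_itv/= andbT => s0.
case: Lrho => _ /(_ s s0) r0 _; apply: mulr_ge0 => //.
by apply: defect_ge0; rewrite mulr_ge0// ltW.
Qed.

Lemma measurable_levy_defect (u : R) :
  measurable_fun pos (fun s => (1 - expR (- (u * s))) * rho s).
Proof.
apply: measurable_funM; last by case: Lrho.
by apply: measurable_funB => //; exact: measurable_expRNM.
Qed.

Let bound (u s : R) := (1 + u) * (Num.min 1 s * rho s).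

Let integrable_bound (u : R) : 0 <= u -> mu.-integrable pos (EFin \o bound u).
Proof.
move=> u0; case: Lrho => mr r0 intr.
have mmin : measurable_fun pos (fun s : R => Num.min 1 s * rho s).
  by apply: measurable_funM => //; exact: measurable_minr.
have : mu.-integrable pos (fun s : R => (Num.min 1 s * rho s)%:E).
  apply/integrableP; split; first exact/measurable_EFinP.
  rewrite [X in (X < _)%E](_ : _ =
    (\int[mu]_(s in pos) (Num.min 1 s * rho s)%:E)%E)//.
  apply: eq_integral => s; rewrite inE/= in_itv/= andbT => s0.
  by rewrite ger0_norm// mulr_ge0 ?r0// le_min ler01 ltW.
move=> /(integrableZl _ (1 + u)) => /(_ ltac:(exact: measurable_itv)).
by apply: eq_integrable => // s _.
Qed.

Lemma integrable_levy_defect (u : R) : 0 <= u ->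
  mu.-integrable pos (fun s : R => ((1 - expR (- (u * s))) * rho s)%:E).
Proof.
move=> u0; apply: (le_integrable _ _ _ (integrable_bound u0)).
- exact: measurable_itv.
- by apply/measurable_EFinP; exact: measurable_levy_defect.
move=> s ps; have s0 : 0 < s by move: ps; rewrite /= in_itv/= andbT.
case: (Lrho) => _ r0 _.
have b0 : 0 <= bound u s 
  by rewrite /bound mulr_ge0 ?addr_ge0// mulr_ge0 ?r0// le_min ler01 ltW.
rewrite /= lee_fin ger0_norm ?levy_defect_ge0// ger0_norm// /bound mulrA.
by rewrite ler_wpM2r ?r0// defect_le.
Qed.

Lemma levy_exponentE (u : R) : 0 <= u -> ((levy_exponent rho u)%:E =
  \int[mu]_(s in pos) ((1 - expR (- (u * s))) * rho s)%:E)%E.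
Proof.
move=> u0; rewrite /levy_exponent /Rintegral fineK//.
by apply: integrable_fin_num => //; exact: integrable_levy_defect.
Qed.

Lemma levy_exponent_ge0 (u : R) : 0 <= u -> 0 <= levy_exponent rho u.
Proof.
move=> u0; apply: Rintegral_ge0 => s ps; exact: levy_defect_ge0.
Qed.

Lemma levy_exponent0 : levy_exponent rho 0 = 0.
Proof.
rewrite /levy_exponent /Rintegral integral0_eq// => s _.
by rewrite mul0r oppr0 expR0 subrr mul0r.
Qed.

Lemma levy_exponent_extE (u : R) : 0 <= u ->
  levy_exponent_ext rho u = levy_exponent rho u.
Proof. by rewrite /levy_exponent_ext => /max_idPr ->. Qed.

Lemma levy_exponent_ext_ge0 (u : R) : 0 <= levy_exponent_ext rho u.
Proof. by apply: levy_exponent_ge0; rewrite le_max lexx. Qed.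

Lemma continuous_levy_exponent_ext : continuous (levy_exponent_ext rho).
Proof.
move=> a; have : a \in [set` `]a - 1, a + 1[] by rewrite inE/= in_itv/=; lra.
pose f (u s : R) := (1 - expR (- (Num.max 0 u * s))) * rho s.
have max0 (u : R) : 0 <= Num.max 0 u by rewrite le_max lexx.
apply: (@continuity_under_integral _ _ _ mu f pos _ _ _ _ _
  (bound (Num.max 0 (a + 1)))) => //.
- by move=> u _; exact: integrable_levy_defect.
- apply: aeW => s _ u _; apply: cvgMl; apply: cvgB; first exact: cvg_cst.
  apply: continuous_comp; last exact: continuous_expR.
  apply: cvgN; apply: cvgMl.
  by apply: continuous_max; [exact: cvg_cst|exact: cvg_id].
- exact: integrable_bound.
- move=> u; rewrite /= in_itv/= => /andP[_ ua]; apply: aeW => s ps.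
  have s0 : 0 < s by move: ps; rewrite /= in_itv/= andbT.
  case: (Lrho) => _ r0 _.
  rewrite /f ger0_norm ?levy_defect_ge0// /bound mulrA ler_wpM2r ?r0//.
  apply: (le_trans (defect_le _ s0)) => //.
  apply: ler_wpM2r; first by rewrite le_min ler01 ltW.
  rewrite lerD2l.
  by rewrite ge_max max0 le_max (ltW ua) orbT.
Qed.

End levy_exponent_continuity.

Section levy_density_sum.
Context {R : realType}.
Local Notation mu := (@lebesgue_measure R).
Variables rho1 rho2 : R -> R.
Hypotheses (L1 : levy_density rho1) (L2 : levy_density rho2).

Lemma levy_densityD : levy_density (fun x => rho1 x + rho2 x).
Proof.
case: L1 L2 => m1 r1 i1 [m2 r2 i2]; split.
- exact: measurable_funD.
- by move=> x x0; rewrite addr_ge0 ?r1 ?r2.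
- under eq_integral do rewrite mulrDr EFinD.
  rewrite ge0_integralD//.
  + exact: lte_add_pinfty.
  + move=> x; rewrite /= in_itv/= andbT => x0.
    by rewrite lee_fin mulr_ge0 ?r1// le_min ler01 ltW.
  + apply/measurable_EFinP; apply: measurable_funM => //.
    exact: measurable_minr.
  + move=> x; rewrite /= in_itv/= andbT => x0.
    by rewrite lee_fin mulr_ge0 ?r2// le_min ler01 ltW.
  + apply/measurable_EFinP; apply: measurable_funM => //.
    exact: measurable_minr.
Qed.

Lemma levy_exponentD (u : R) : 0 <= u ->
  levy_exponent (fun x => rho1 x + rho2 x) u =
  levy_exponent rho1 u + levy_exponent rho2 u.
Proof.
move=> u0; rewrite /levy_exponent -RintegralD//.
- by apply: eq_Rintegral => s _; rewrite mulrDr.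
- exact: (integrable_levy_defect L1).
- exact: (integrable_levy_defect L2).
Qed.

End levy_density_sum.

Section levy_exponent_identities.
Context {R : realType}.
Local Notation mu := (@lebesgue_measure R).
Variable rho : R -> R.
Hypothesis sd : self_decomposable rho.
Hypothesis drho : forall x, 0 < x -> derivable rho x 1.
Hypothesis Lrho : levy_density rho.
Hypothesis LZ : levy_density (fun x => - (x * derive1 rho x)).

Local Notation psi := (levy_exponent rho).
Local Notation psiZ := (levy_exponent_ext (fun x => - (x * derive1 rho x))).

Let psiZ_cont : continuous psiZ. Proof. exact: continuous_levy_exponent_ext. Qed.

Let psiZ_ge0 u : 0 <= psiZ u. Proof. exact: levy_exponent_ext_ge0. Qed.

Let psiZ_int (a b : R) : mu.-integrable `[a, b] (EFin \o psiZ).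
Proof.
apply: continuous_compact_integrable; first exact: segment_compact.
exact: continuous_subspaceT.
Qed.

Lemma Rintegral_levy_exponent (u : R) : 0 <= u ->
  \int[mu]_(v in `[0, u]) psiZ v = u * psi u.
Proof.
move=> u0; rewrite /Rintegral -[RHS]/(fine (u * psi u)%:E); congr fine.
rewrite EFinM (levy_exponentE Lrho u0) -levy_exponent_average//.
apply: eq_integral => v; rewrite inE/= in_itv/= => /andP[v0 _].
by rewrite levy_exponent_extE// levy_exponentE.
Qed.

(** Near [u] the exponent is v^-1 times the integral of the continuous function
    [psiZ] over [0, v], by [Rintegral_levy_exponent]. *)
Lemma derivable_levy_exponent (u : R) : 0 < u ->
  derivable psi u 1 /\ u * derive1 psi u = psiZ u - psi u.
Proof.
move=> u0; pose F (v : R) : R := \int[mu]_(w in `[0, v]) psiZ w.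
have [dF F'] : derivable F u 1 /\ derive1 F u = psiZ u.
  by apply: (@continuous_FTC1_closed _ _ 0 u (u + 1));
    [by rewrite ltrDl|exact: psiZ_int|done|exact: psiZ_cont].
have isF : is_derive u (1 : R) F (psiZ u).
  by rewrite -F' derive1E; exact: DeriveDef.
have isG : is_derive u (1 : R) (fun v => F v * v^-1) ((psiZ u - psi u) / u).
  have := is_deriveM isF (is_deriveV (lt0r_neq0 u0) (is_derive_id u (1 : R))).
  move=> /is_derive_eq; apply.
  rewrite /F Rintegral_levy_exponent ?ltW// /GRing.scale/=; field.
  by rewrite gt_eqF.
have isP : is_derive u (1 : R) psi ((psiZ u - psi u) / u).
  apply: near_eq_is_derive isG.
  near=> v; have v0 : 0 < v by near: v; exact: lt_nbhsr.
  by rewrite /F Rintegral_levy_exponent ?ltW// mulrAC mulfV ?mul1r// gt_eqF.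
split; first by case: isP.
by rewrite derive1E (@derive_val _ _ _ _ _ _ _ isP) mulrC divfK// gt_eqF.
Unshelve. all: by end_near. Qed.

(** Substituting v = c (b - s) reduces this to [Rintegral_levy_exponent]. It is
    what a clock kernel with slope [c] contributes to a Laplace exponent. *)
Lemma Rintegral_levy_exponent_ramp (a b c : R) : a <= b -> 0 <= c ->
  \int[mu]_(s in `[a, b]) psiZ (c * (b - s)) = (b - a) * psi (c * (b - a)).
Proof.
move=> ab; rewrite le_eqVlt => /predU1P[<-|c0].
  rewrite mul0r levy_exponent0 mulr0 (@eq_Rintegral _ _ _ _ _ (fun=> 0)).
    by rewrite Rintegral_cst// mul0r.
  by move=> s _; rewrite mul0r levy_exponent_extE// levy_exponent0.
(* starting at -1 instead of 0 makes F differentiable at 0 as well; the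
   integrand vanishes there *)
pose F (v : R) : R := \int[mu]_(w in `[-1, v]) psiZ w.
have dF (v : R) : 0 <= v -> is_derive v (1 : R) F (psiZ v).
  move=> v0.
  have [dF F'] : derivable F v 1 /\ derive1 F v = psiZ v.
    apply: (@continuous_FTC1_closed _ _ (-1) v (v + 1));
      [by rewrite ltrDl|exact: psiZ_int|lra|exact: psiZ_cont].
  by rewrite -F' derive1E; exact: DeriveDef.
pose G (s : R) : R := (- c^-1) * F (c * (b - s)).
have dG (s : R) : a <= s <= b -> is_derive s (1 : R) G (psiZ (c * (b - s))).
  move=> /andP[as_ sb].
  have cs : 0 <= c * (b - s) by rewrite mulr_ge0 ?subr_ge0 ?(ltW c0).
  have l : is_derive s (1 : R) (fun s : R => c * (b - s)) (- c).
    by apply: is_derive_eq; rewrite /GRing.scale/=; ring.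
  have dFl := @is_derive1_comp _ F (fun s : R => c * (b - s)) s _ _ (dF _ cs) l.
  have : is_derive s (1 : R) G ((- c^-1) *: (psiZ (c * (b - s)) * - c)).
    exact: (@is_deriveZ _ _ _ _ (- c^-1) _ _ _ dFl).
  move=> /is_derive_eq; apply.
  rewrite /GRing.scale/=; field; by rewrite gt_eqF.
have G'E (s : R) : a <= s <= b -> derive1 G s = psiZ (c * (b - s)).
  by move=> /dG H; rewrite derive1E (@derive_val _ _ _ _ _ _ _ H).
have mpsi : measurable_fun `[a, b] (fun s : R => psiZ (c * (b - s))).
  apply: (measurableT_comp (continuous_measurable_fun psiZ_cont)).
  by apply: measurable_funM => //; exact: measurable_funB.
rewrite /Rintegral.
have -> : (\int[mu]_(s in `[a, b]) (psiZ (c * (b - s)))%:E = (G b - G a)%:E)%E.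
  rewrite -(FTC2_nondecreasing ab).
  - by apply: eq_integral => s; rewrite inE/= in_itv/= => /G'E ->.
  - by move=> s /dG [].
  - apply: (eq_measurable_fun (fun s : R => psiZ (c * (b - s)))) => //.
    by move=> s; rewrite inE/= in_itv/= => /G'E ->.
  - by move=> s /G'E ->.
rewrite /= /G subrr mulr0.
have -> : - c^-1 * F 0 - (- c^-1 * F (c * (b - a))) =
  c^-1 * (F (c * (b - a)) - F 0) by ring.
have cba : 0 <= c * (b - a) by rewrite mulr_ge0 ?subr_ge0 ?(ltW c0).
rewrite /F Rintegral_itvB;
  [|exact: psiZ_int|by rewrite bnd_simp; lra|by rewrite bnd_simp].
rewrite Rintegral_itv_obnd_cbnd; last first.
  apply: (integrableS _ _ _ (psiZ_int 0 (c * (b - a)))) => //.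
  exact: subset_itv_oc_cc.
rewrite Rintegral_levy_exponent//; field.
by rewrite gt_eqF.
Qed.

End levy_exponent_identities.

(** * The exponent of the Ornstein-Uhlenbeck driving process *)

Section tail_integral.
Context {R : realType}.
Local Notation mu := (@lebesgue_measure R).

(** [phi a] is the integral of [k] over [a, +oo[. With a primitive [K] of [k],
    the limit of K(b + n) does not depend on [b], by monotonicity, so that
    phi + K is constant. *)
Lemma is_derive_tail_integral (k phi : R -> R) : continuous k ->
  (forall r, 0 <= k r) ->
  (forall a, \int[mu]_(s in `[0, n%:R]) k (a + s) @[n --> \oo] --> phi a) ->
  forall a, is_derive a (1 : R) phi (- k a).
Proof.
move=> ck k0 cphi a; pose c := a - 1.
have ki (x y : R) : mu.-integrable `[x, y] (EFin \o k).
  apply: continuous_compact_integrable; first exact: segment_compact.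
  exact: continuous_subspaceT.
pose K (r : R) : R := \int[mu]_(w in `[c, r]) k w.
have dK (r : R) : c < r -> is_derive r (1 : R) K (k r).
  move=> cr; have [dK K'] : derivable K r 1 /\ derive1 K r = k r.
    by apply: (@continuous_FTC1_closed _ _ c r (r + 1));
      [by rewrite ltrDl|exact: ki|exact: cr|exact: ck].
  by rewrite -K' derive1E; exact: DeriveDef.
have Kmono (x y : R) : c < x -> x <= y -> K x <= K y.
  move=> cx xy; rewrite -subr_ge0 /K Rintegral_itvB.
  - by apply: Rintegral_ge0 => s _; exact: k0.
  - exact: ki.
  - by rewrite bnd_simp ltW.
  - by rewrite bnd_simp.
have IK (b : R) (n : nat) : c < b ->
    \int[mu]_(s in `[0, n%:R]) k (b + s) = K (b + n%:R) - K b.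
  move=> cb; pose G (s : R) : R := K (b + s).
  have dG (s : R) : 0 <= s -> is_derive s (1 : R) G (k (b + s)).
    move=> s0; have l : is_derive s (1 : R) (fun s : R => b + s) 1.
      by apply: is_derive_eq; rewrite /GRing.scale/=; ring.
    have cbs : c < b + s by lra.
    have := @is_derive1_comp _ K (fun s : R => b + s) s _ _ (dK _ cbs) l.
    by rewrite mulr1.
  have G'E (s : R) : 0 <= s -> derive1 G s = k (b + s).
    by move=> /dG H; rewrite derive1E (@derive_val _ _ _ _ _ _ _ H).
  rewrite /Rintegral.
  have -> : (\int[mu]_(s in `[0%R, n%:R]) (k (b + s)%R)%:E =
      (G n%:R - G 0)%:E)%E.
    rewrite -FTC2_nondecreasing//.
    - by apply: eq_integral => s; rewrite inE/= in_itv/= => /andP[/G'E ->].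
    - by move=> s /andP[/dG []].
    - apply: (eq_measurable_fun (fun s : R => k (b + s))).
        by move=> s; rewrite inE/= in_itv/= => /andP[/G'E ->].
      apply: (measurableT_comp (continuous_measurable_fun ck)).
      exact: measurable_funD.
    - by move=> s /andP[/G'E -> _].
  by rewrite /= /G addr0.
have cK (b : R) : c < b -> K (b + n%:R) @[n --> \oo] --> phi b + K b.
  move=> cb; rewrite (_ : (fun n => _) = (fun n : nat =>
      \int[mu]_(s in `[0, n%:R]) k (b + s) + K b)); last first.
    by apply/funext => n; rewrite IK// subrK.
  by apply: cvgD; [exact: cphi|exact: cvg_cst].
have le_lim (b b' : R) : c < b -> c < b' -> phi b + K b <= phi b' + K b'.
  move=> cb cb'; have Kle (n : nat) : K (b' + n%:R) <= phi b' + K b'.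
    rewrite -(cvg_lim _ (cK _ cb'))//.
    apply: (nondecreasing_cvgn_le (u_ := fun n : nat => K (b' + n%:R))).
      move=> i j ij; apply: Kmono; last by rewrite lerD2l ler_nat.
      by have : (0 : R) <= i%:R by []; lra.
    by apply/cvg_ex; eexists; exact: cK.
  apply: (cvgr_to_le (cK _ cb)).
  apply: nearW => n; pose m := (Num.truncn `|b - b'|).+1.
  apply: (le_trans _ (Kle (n + m)%N)).
  have n0 : (0 : R) <= n%:R by [].
  apply: Kmono; first by lra.
  rewrite natrD; have := truncnS_gt `|b - b'|; rewrite -/m.
  by have := ler_norm (b - b'); lra.
have phiE (b : R) : c < b -> phi b = phi a + K a - K b.
  move=> cb; have ca : c < a by rewrite /c; lra.
  by apply/eqP; rewrite eq_sym subr_eq eq_le !le_lim.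
have ca : c < a by rewrite /c; lra.
have isG : is_derive a (1 : R) (fun b : R => (phi a + K a) - K b) (- k a).
  have dKa := dK _ ca.
  by apply: is_derive_eq; ring.
apply: near_eq_is_derive isG.
by near=> b; rewrite [RHS]phiE//; near: b; exact: lt_nbhsr.
Unshelve. all: by end_near. Qed.

(** In the variable a = - ln u, the hypothesis says that psi(exp(- a)) is the
    integral of psiT(exp(- r)) over r in [a, +oo[. Differentiating in [a] gives
    psiT(u) = u psi'(u). *)
Lemma exponent_of_OU_tail (psi psiV psiT : R -> R) : continuous psiT ->
  (forall r, 0 <= psiT r) ->
  (forall u, 0 < u -> derivable psi u 1 /\ u * derive1 psi u = psiV u) ->
  (forall u, 0 < u ->
    \int[mu]_(s in `[0, n%:R]) psiT (u * expR (- s)) @[n --> \oo] --> psi u) ->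
  forall u, 0 < u -> psiT u = psiV u.
Proof.
move=> cT T0 dpsi cpsi u u0; pose a := - ln u.
have ua : expR (- a) = u by rewrite /a opprK lnK.
pose k (r : R) : R := psiT (expR (- r)).
have ck : continuous k.
  move=> r; apply: continuous_comp; last exact: cT.
  by apply: continuous_comp; [exact: opp_continuous|exact: continuous_expR].
have tail b : \int[mu]_(s in `[0, n%:R]) k (b + s) @[n --> \oo] -->
    psi (expR (- b)).
  have := cpsi _ (expR_gt0 (- b)).
  by under eq_fun do under eq_Rintegral do rewrite -expRD -opprD -/(k _).
have H1 := is_derive_tail_integral ck (fun r => T0 _) tail a.
have e0 := expR_gt0 (- a).
have [dp p'] := dpsi _ e0.
have l : is_derive a (1 : R) (fun r : R => expR (- r)) (- expR (- a)).
  by apply: is_derive_eq; rewrite /GRing.scale/= mulrN1.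
have dpsi' : is_derive (expR (- a)) (1 : R) psi (derive1 psi (expR (- a))).
  by rewrite derive1E; exact: DeriveDef.
have H2 := @is_derive1_comp _ psi (fun r : R => expR (- r)) a _ _ dpsi' l.
have := @derive_val _ _ _ _ _ _ _ H1.
rewrite (@derive_val _ _ _ _ _ _ _ H2) mulrN mulrC p' ua => /oppr_inj.
by rewrite /k ua.
Qed.

End tail_integral.

(** * Uniqueness for Laplace transforms on the half-line *)

Section laplace_kernel.
Context {R : realType}.

Lemma pow_onem_ge (a : R) (m : nat) : 0 <= a <= 1 ->
  1 - m%:R * a <= (1 - a) ^+ m.
Proof.
move=> /andP[a0 a1]; elim: m => [|m IH]; first by rewrite mul0r subr0 expr0.
rewrite exprS; have := ler_wpM2l _ IH => /(_ (1 - a) ltac:(lra)).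
have : 0 <= m%:R * a * a by rewrite !mulr_ge0.
rewrite -natr1; lra.
Qed.

Lemma pow_onem_le (a : R) (m : nat) : 0 <= a <= 1 ->
  (1 - a) ^+ m * (1 + m%:R * a) <= 1.
Proof.
move=> /andP[a0 a1]; elim: m => [|m IH]; first by rewrite mul0r addr0 expr0 mul1r.
apply: le_trans IH; rewrite exprSr -mulrA ler_wpM2l ?exprn_ge0 ?subr_ge0//.
have : 0 <= m%:R * a * a by rewrite !mulr_ge0.
have : 0 <= a * a by rewrite mulr_ge0.
rewrite -natr1; lra.
Qed.

(** Write z = w^2: then n w^n stays bounded, by Bernoulli's inequality, and the
    other factor w^n tends to 0. *)
Lemma cvg_natmul_geometric (z : R) : 0 <= z < 1 ->
  n%:R * z ^+ n @[n --> \oo] --> (0 : R).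
Proof.
move=> /andP[z0 z1]; pose w := Num.sqrt z.
have w0 : 0 <= w by exact: sqrtr_ge0.
have w1 : w < 1 by rewrite -sqrtr1 ltr_sqrt.
have a0 : 0 < 1 - w by lra.
have nw (n : nat) : n%:R * w ^+ n <= (1 - w)^-1.
  have := @pow_onem_le (1 - w) n; rewrite subKr => /(_ ltac:(lra)) H.
  rewrite -[leRHS]mul1r ler_pdivlMr// mulrAC mulrC.
  by apply: le_trans H; rewrite ler_wpM2l ?exprn_ge0//; lra.
apply: (@squeeze_cvgr _ _ _ _ (fun=> 0) (fun n => (1 - w)^-1 * w ^+ n)).
- apply: nearW => n; rewrite mulr_ge0 ?exprn_ge0//=.
  have -> : z = w * w by rewrite -expr2 sqr_sqrtr.
  by rewrite exprMn mulrA ler_wpM2r ?exprn_ge0.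
- exact: cvg_cst.
- rewrite -(mulr0 (1 - w)^-1); apply: cvgMr; apply: cvg_expr.
  by rewrite ger0_norm.
Qed.

(** A polynomial in exp(- x ln 2 / c) that approximates the indicator of
    ]c, +oo[: with y = exp(- x ln 2 / c), which is less than 1/2 exactly when
    c < x, it is (1 - y^n)^m for m = n 2^n. The factor [n] in the exponent is
    there to make the limit 0 also at the threshold y = 1/2. *)
Definition laplace_kernel (c : R) (n : nat) (x : R) : R :=
  (1 - expR (- (n%:R * (ln 2 / c) * x))) ^+ (n * 2 ^ n).

(** With m y^n = n (2 y)^n, Bernoulli's inequality bounds the kernel from below
    by 1 - n (2 y)^n, which tends to 1 when 2 y < 1, and from above by
    1 / (1 + n (2 y)^n), which tends to 0 when 2 y >= 1. *)
Lemma cvg_laplace_kernel (c x : R) : 0 < c -> 0 <= x ->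
  laplace_kernel c n x @[n --> \oo] --> ((c < x)%R%:R : R).
Proof.
move=> c0 x0; pose y := expR (- (ln 2 / c * x)).
have ln20 : 0 < ln 2 :> R by rewrite ln_gt0// ltr1n.
have y0 : 0 <= y by exact: expR_ge0.
have y1 : y <= 1.
  by rewrite -expR0 ler_expR oppr_le0 !mulr_ge0// ?invr_ge0 ltW.
have yn (n : nat) : 0 <= y ^+ n <= 1 by rewrite exprn_ge0//= exprn_ile1.
have kE (n : nat) : laplace_kernel c n x = (1 - y ^+ n) ^+ (n * 2 ^ n).
  by rewrite /laplace_kernel /y -expRM_natl; congr ((1 - expR _) ^+ _); ring.
have mE (n : nat) : (n * 2 ^ n)%:R * y ^+ n = n%:R * (2 * y) ^+ n.
  by rewrite natrM natrX exprMn mulrA.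
under eq_fun do rewrite kE.
have half : expR (- ln 2) = 2^-1 :> R by rewrite expRN lnK// posrE.
have [cx|xc] := ltP c x.
  have y2 : 2 * y < 1.
    rewrite -ltr_pdivlMl// mulr1 -half ltr_expR ltrN2.
    by rewrite mulrAC ltr_pdivlMr// ltr_pM2l.
  apply: (@squeeze_cvgr _ _ _ _ (fun n : nat => 1 - n%:R * (2 * y) ^+ n) (fun=> 1)).
  - apply: nearW => n; rewrite -mE pow_onem_ge//=.
    by apply: exprn_ile1; have := yn n; lra.
  - rewrite -[X in _ --> X]subr0; apply: cvgB; first exact: cvg_cst.
    by apply: cvg_natmul_geometric; rewrite y2 mulr_ge0.
  - exact: cvg_cst.
have y2 : 1 <= 2 * y.
  rewrite -ler_pdivrMl// mulr1 -half ler_expR lerN2.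
  by rewrite mulrAC ler_pdivrMr// ler_pM2l.
apply: (@squeeze_cvgr _ _ _ _ (fun=> 0) (fun n : nat => n.+1%:R^-1)).
- apply: nearW => n; rewrite exprn_ge0 ?subr_ge0/=; last by case/andP: (yn n).
  rewrite -[leRHS]mul1r ler_pdivlMr//.
  apply: le_trans (pow_onem_le (n * 2 ^ n) (yn n)).
  rewrite ler_wpM2l ?exprn_ge0 ?subr_ge0//; first by case/andP: (yn n).
  rewrite mE -nat1r lerD2l -[leLHS]mulr1 ler_wpM2l//.
  by rewrite exprn_ege1.
- exact: cvg_cst.
- exact: cvg_harmonic.
Qed.

End laplace_kernel.

Section laplace_one_space.
Context {R : realType} d (T : measurableType d).
Variables (mu : {measure set T -> \bar R}) (D : set T) (X g : T -> R).
Hypothesis mD : measurable D.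
Hypothesis mX : measurable_fun D X.
Hypothesis X0 : forall t, D t -> 0 <= X t.
Hypothesis g0 : forall t, D t -> 0 <= g t.
Hypothesis ig : mu.-integrable D (EFin \o g).

Let f (v w : R) (m : nat) (t : T) : R :=
  g t * (expR (- (w * X t)) * (1 - expR (- (v * X t))) ^+ m).

Let mg : measurable_fun D g.
Proof. by case/integrableP : ig => /measurable_EFinP. Qed.

Let mf v w m : measurable_fun D (f v w m).
Proof.
apply: measurable_funM => //; apply: measurable_funM.
  exact: measurable_expRNM.
apply: measurable_funX; apply: measurable_funB => //.
exact: measurable_expRNM.
Qed.

Let e01 (w : R) t : 0 <= w -> D t -> 0 <= expR (- (w * X t)) <= 1.
Proof.
move=> w0 Dt; rewrite expR_ge0/= -expR0 ler_expR oppr_le0 mulr_ge0//.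
exact: X0.
Qed.

Let fle (v w : R) m t : 0 <= v -> 0 <= w -> D t -> 0 <= f v w m t <= g t.
Proof.
move=> v0 w0 Dt; have /andP[a0 a1] := e01 w0 Dt; have /andP[b0 b1] := e01 v0 Dt.
have c0 : 0 <= (1 - expR (- (v * X t))) ^+ m by rewrite exprn_ge0// subr_ge0.
rewrite /f !mulr_ge0 ?g0//= -[leRHS]mulr1 ler_wpM2l ?g0// -[leRHS]mulr1.
by rewrite ler_pM// exprn_ile1 ?subr_ge0// lerBlDr lerDl.
Qed.

Let f_int (v w : R) m : 0 <= v -> 0 <= w -> mu.-integrable D (EFin \o f v w m).
Proof.
move=> v0 w0; apply: le_integrable ig => //; first exact/measurable_EFinP.
move=> t Dt; have /andP[a b] := fle m v0 w0 Dt.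
by rewrite /= lee_fin !ger0_norm// g0.
Qed.

Lemma integral_laplace_rec (v w : R) m : 0 <= v -> 0 <= w ->
  (\int[mu]_(t in D)
     (g t * (expR (- (w * X t)) * (1 - expR (- (v * X t))) ^+ m.+1))%:E =
   \int[mu]_(t in D)
     (g t * (expR (- (w * X t)) * (1 - expR (- (v * X t))) ^+ m))%:E -
   \int[mu]_(t in D)
     (g t * (expR (- ((w + v) * X t)) * (1 - expR (- (v * X t))) ^+ m))%:E)%E.
Proof.
move=> v0 w0; rewrite -integralB//.
- apply: eq_integral => t _; rewrite -EFinB; congr EFin.
  by rewrite mulrDl opprD expRD exprS; ring.
- exact: (f_int m v0 w0).
- exact: (f_int m v0 (addr_ge0 w0 v0)).
Qed.

Lemma cvg_integral_laplace (c : R) : 0 < c ->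
  (\int[mu]_(t in D) (g t * (expR (- (0 * X t)) * laplace_kernel c n (X t)))%:E
    @[n --> \oo] --> \int[mu]_(t in D `&` [set t | (c < X t)%R]) (g t)%:E)%E.
Proof.
move=> c0; rewrite integral_mkcondr.
have v0 (n : nat) : 0 <= n%:R * (ln 2 / c) :> R.
  by rewrite !mulr_ge0 ?ln_ge0 ?invr_ge0 ?(ltW c0)// ler1n.
have E : ((fun t => (g t)%:E) \_ [set t | (c < X t)%R])%E =
    (fun t => (g t * (c < X t)%R%:R)%:E).
  apply/funext => t; rewrite /patch; have [cX|cX] := boolP (c < X t).
    by rewrite mem_set// mulr1.
  by rewrite memNset ?mulr0//; exact/negP.
rewrite E.
pose F n t := (f (n%:R * (ln 2 / c)) 0 (n * 2 ^ n) t)%:E.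
have [] // := @dominated_convergence _ _ _ mu D mD F
  (fun t => (g t * (c < X t)%R%:R)%:E) (EFin \o g).
- by move=> n; apply/measurable_EFinP; exact: mf.
- apply/measurable_EFinP; apply: measurable_funM => //.
  apply: (measurableT_comp (f := fun b : bool => b%:R : R)) => //.
  by apply: measurable_fun_ltr.
- apply: aeW => t Dt; apply: cvg_EFin; first exact: nearW.
  rewrite /F /f /=; apply: cvgMr.
  under eq_fun do rewrite mul0r oppr0 expR0 mul1r.
  exact: (cvg_laplace_kernel c0 (X0 Dt)).
- apply: aeW => t n Dt; have /andP[a b] := fle (n * 2 ^ n) (v0 n) (lexx 0) Dt.
  by rewrite /F /= lee_fin ger0_norm.
Qed.

End laplace_one_space.

(** The transforms determine the integrals of all polynomials in exp(- v X), by
    induction on the power of 1 - exp(- v X), hence the limits of those of the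
    kernels. The weights allow to treat probability laws (weight 1) and Levy
    densities (weight (1 - exp(- s)) rho(s)) at once. *)
Lemma laplace_tail_unique (R : realType) d1 d2 (T1 : measurableType d1)
    (T2 : measurableType d2) (mu1 : {measure set T1 -> \bar R})
    (mu2 : {measure set T2 -> \bar R}) (D1 : set T1) (D2 : set T2)
    (X1 g1 : T1 -> R) (X2 g2 : T2 -> R) :
  measurable D1 -> measurable D2 ->
  measurable_fun D1 X1 -> measurable_fun D2 X2 ->
  (forall t, D1 t -> 0 <= X1 t) -> (forall t, D2 t -> 0 <= X2 t) ->
  (forall t, D1 t -> 0 <= g1 t) -> (forall t, D2 t -> 0 <= g2 t) ->
  mu1.-integrable D1 (EFin \o g1) -> mu2.-integrable D2 (EFin \o g2) ->
  (forall u : R, 0 <= u -> (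
    \int[mu1]_(t in D1) (g1 t * expR (- (u * X1 t)))%:E =
    \int[mu2]_(t in D2) (g2 t * expR (- (u * X2 t)))%:E)%E) ->
  forall c, 0 < c ->
    (\int[mu1]_(t in D1 `&` [set t | (c < X1 t)%R]) (g1 t)%:E =
     \int[mu2]_(t in D2 `&` [set t | (c < X2 t)%R]) (g2 t)%:E)%E.
Proof.
move=> mD1 mD2 mX1 mX2 X10 X20 g10 g20 ig1 ig2 L c c0.
have key (v : R) m : 0 <= v -> forall w, 0 <= w ->
    (\int[mu1]_(t in D1) (g1 t * (expR (- (w * X1 t)) *
       (1 - expR (- (v * X1 t))) ^+ m))%:E =
     \int[mu2]_(t in D2) (g2 t * (expR (- (w * X2 t)) *
       (1 - expR (- (v * X2 t))) ^+ m))%:E)%E.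
  move=> v0; elim: m => [|m IH] w w0.
    under eq_integral do rewrite expr0 mulr1.
    by under [RHS]eq_integral do rewrite expr0 mulr1; exact: L.
  rewrite !integral_laplace_rec// IH//; congr (_ - _)%E.
  by apply: IH; rewrite addr_ge0.
have v0 (n : nat) : 0 <= n%:R * (ln 2 / c) :> R.
  by rewrite !mulr_ge0 ?ln_ge0 ?invr_ge0 ?(ltW c0)// ler1n.
have c1 := cvg_integral_laplace mD1 mX1 X10 g10 ig1 c0.
have c2 := cvg_integral_laplace mD2 mX2 X20 g20 ig2 c0.
apply: (cvg_unique _ c1) => //; apply: cvg_trans c2.
apply: near_eq_cvg; apply: nearW => n.
exact/esym/(key _ _ (v0 n) 0 (lexx 0)).
Qed.

(** * Expectations of functions of independent variables *)

Section integral_from_sets.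
Context {R : realType}.
Local Notation mu := (@lebesgue_measure R).

Lemma layer_cake d (T : measurableType d)
    (P : {sigma_finite_measure set T -> \bar R}) (F Y : T -> R) :
  measurable_fun [set: T] F -> measurable_fun [set: T] Y ->
  (forall t, 0 <= F t) -> (forall t, 0 <= Y t <= 1) ->
  (\int[P]_t (F t * Y t)%:E =
   \int[mu]_(s in `[0%R, 1%R]) \int[P]_(t in [set t | (s < Y t)%R]) (F t)%:E)%E.
Proof.
move=> mF mY F0 Y01.
pose K t (s : R) : R := if s < Y t then F t else 0.
have K0 t s : 0 <= K t s by rewrite /K; case: ifP.
transitivity (\int[P]_t \int[mu]_(s in `[0%R, 1%R]) (K t s)%:E)%E.
  apply: eq_integral => t _; have /andP[Y0 Y1] := Y01 t.
  transitivity (\int[mu]_(s in `[0%R, Y t[) (F t)%:E)%E.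
    rewrite integral_cst//= lebesgue_measure_itv/= lte_fin.
    case: ltP => Yt; first by rewrite sube0 -EFinM.
    have -> : Y t = 0 by lra.
    by rewrite mule0 mulr0.
  have -> : [set` `[0, Y t[] = [set` `[0, 1]] `&` [set s | s < Y t].
    apply/seteqP; split => s /=; rewrite !in_itv/=.
      by move=> /andP[-> sY]; rewrite sY (le_trans (ltW sY)).
    by move=> [/andP[-> _] ->].
  rewrite integral_mkcondr; apply: eq_integral => s _; rewrite /patch /K.
  have -> : (s \in [set s | s < Y t]) = (s < Y t).
    by apply/idP/idP; rewrite inE.
  by case: ifP.
rewrite (@tonelli_on _ _ _ _ _ P mu setT _ K)//.
- apply: eq_integral => s _; rewrite [RHS]integral_mkcond.
  apply: eq_integral => t _; rewrite /patch /K.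
  have -> : (t \in [set t | s < Y t]) = (s < Y t).
    by apply/idP/idP; rewrite inE.
  by case: ifP.
- apply: measurable_fun_if.
  + by apply: measurableX => //.
  + apply: measurable_fun_ltr; first exact: measurable_funTS.
    by apply: measurable_funTS; exact: measurableT_comp.
  + apply: measurable_funTS; exact: measurableT_comp.
  + exact: measurable_cst.
Qed.

(** Both integrals are superpositions of the integrals over the level sets
    {s < f(X)}. The weights make this usable twice: constant ones transfer
    expectations between equal laws, and a random one on the left against its
    mean on the right expresses independence. *)
Lemma eq_integral_from_sets d1 d2 dE (T1 : measurableType d1)
    (T2 : measurableType d2) (E : measurableType dE)
    (P1 : {sigma_finite_measure set T1 -> \bar R})
    (P2 : {sigma_finite_measure set T2 -> \bar R})
    (X1 : T1 -> E) (X2 : T2 -> E) (F1 : T1 -> R) (F2 : T2 -> R) (f : E -> R) :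
  measurable_fun [set: T1] X1 -> measurable_fun [set: T2] X2 ->
  measurable_fun [set: T1] F1 -> measurable_fun [set: T2] F2 ->
  (forall t, 0 <= F1 t) -> (forall t, 0 <= F2 t) ->
  (forall B, measurable B ->
    \int[P1]_(t in X1 @^-1` B) (F1 t)%:E =
    \int[P2]_(t in X2 @^-1` B) (F2 t)%:E)%E ->
  measurable_fun [set: E] f -> (forall x, 0 <= f x <= 1) ->
  (\int[P1]_t (F1 t * f (X1 t))%:E = \int[P2]_t (F2 t * f (X2 t))%:E)%E.
Proof.
move=> mX1 mX2 mF1 mF2 F10 F20 hB mf f01.
rewrite !layer_cake//; [|exact: measurableT_comp|exact: measurableT_comp].
apply: eq_integral => s _; apply: (hB [set x | s < f x]).
rewrite -[X in measurable X]setTI.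
have -> : [set x | s < f x] = f @^-1` `]s, +oo[.
  by apply/seteqP; split => x /=; rewrite in_itv/= andbT.
exact: mf.
Qed.

Lemma eq_law_integral d1 d2 dE (T1 : measurableType d1)
    (T2 : measurableType d2) (E : measurableType dE) (P1 : probability T1 R)
    (P2 : probability T2 R) (X1 : T1 -> E) (X2 : T2 -> E) (f : E -> R) :
  eq_law P1 X1 P2 X2 ->
  measurable_fun [set: E] f -> (forall x, 0 <= f x <= 1) ->
  (\int[P1]_t (f (X1 t))%:E = \int[P2]_t (f (X2 t))%:E)%E.
Proof.
move=> [mX1 mX2 lawE] mf f01.
have key := @eq_integral_from_sets _ _ _ _ _ _ P1 P2 X1 X2 (fun=> 1) (fun=> 1) f
  mX1 mX2.
transitivity (\int[P1]_t (1 * f (X1 t))%:E)%E.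
  by apply: eq_integral => t _; rewrite mul1r.
transitivity (\int[P2]_t (1 * f (X2 t))%:E)%E; last first.
  by apply: eq_integral => t _; rewrite mul1r.
apply: key => // B mB.
have m1 : measurable (X1 @^-1` B) by rewrite -[X in measurable X]setTI; exact: mX1.
have m2 : measurable (X2 @^-1` B) by rewrite -[X in measurable X]setTI; exact: mX2.
by rewrite !integral_cst// !mul1e; exact: lawE.
Qed.

End integral_from_sets.

Section independent_product.
Context {R : realType} d (T : measurableType d) (P : probability T R).

(** Induction on the number [k] of indicators that have been replaced by
    functions: the statement for [k] keeps the events of index at least [k], and
    the event of index [k], being arbitrary, can be traded for [f k] by
    [eq_integral_from_sets]. *)
Lemma expectation_prod_independent (n : nat) (X : nat -> T -> R)
    (f : nat -> R -> R) :
  (forall i, measurable_fun [set: T] (X i)) ->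
  (forall B : nat -> set R, (forall i, measurable (B i)) ->
    P (\bigcap_(i < n) (X i @^-1` B i)) = (\prod_(i < n) P (X i @^-1` B i))%E) ->
  (forall i, measurable_fun [set: R] (f i)) ->
  (forall i x, 0 <= f i x <= 1) ->
  'E_P[fun t => (\prod_(i < n) f i (X i t))%R]%E =
  (\prod_(i < n) fine 'E_P[fun t => f i (X i t)]%E)%:E.
Proof.
move=> mX ind mf f01; rewrite unlock.
have mfX i : measurable_fun [set: T] (fun t => f i (X i t)) by exact: measurableT_comp.
have mpre i B : measurable B -> measurable (X i @^-1` B).
  by move=> mB; rewrite -[X in measurable X]setTI; exact: mX.
pose e i := fine (\int[P]_t (f i (X i t))%:E)%E.
have eE i : (\int[P]_t (f i (X i t))%:E)%E = (e i)%:E.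
  rewrite fineK// ge0_fin_numE; last first.
    by apply: integral_ge0 => t _; rewrite lee_fin; case/andP: (f01 i (X i t)).
  apply: (@le_lt_trans _ _ (\int[P]_t 1%:E)%E).
    apply: ge0_le_integral => //.
    - by move=> t _; rewrite lee_fin; case/andP: (f01 i (X i t)).
    - exact/measurable_EFinP.
    - by move=> t _; rewrite lee_fin; case/andP: (f01 i (X i t)).
  rewrite integral_cst// mul1e; apply: (@le_lt_trans _ _ 1%:E); last exact: ltry.
  exact: probability_le1.
have e0 i : 0 <= e i.
  rewrite -lee_fin -eE; apply: integral_ge0 => t _.
  by rewrite lee_fin; case/andP: (f01 i (X i t)).
have prod0 k t : 0 <= \prod_(i < k) f i (X i t).
  by apply: prodr_ge0 => i _; case/andP: (f01 i (X i t)).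
have mprod k : measurable_fun [set: T] (fun t => \prod_(i < k) f i (X i t)).
  by apply: measurable_prod => i _.
have mcap B : (forall i, measurable (B i)) ->
    measurable (\bigcap_(i < n) (X i @^-1` B i)).
  by move=> mB; apply: fin_bigcap_measurable => // i _; exact: mpre.
have Q k : (k <= n)%N -> forall B : nat -> set R, (forall i, measurable (B i)) ->
    (forall i, (i < k)%N -> B i = setT) ->
    (\int[P]_(t in \bigcap_(i < n) (X i @^-1` B i))
       (\prod_(i < k) f i (X i t))%R%:E =
     (\prod_(i < k) e i)%R%:E * P (\bigcap_(i < n) (X i @^-1` B i)))%E.
  elim: k => [_ B mB _|k IH kn B mB BT].
    under eq_integral do rewrite big_ord0.
    by rewrite integral_cst ?big_ord0//; exact: mcap.
  set A := \bigcap_(i < n) (X i @^-1` B i).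
  have mA : measurable A by exact: mcap.
  (* inserting an arbitrary event at the index k, where B is the full set *)
  pose B' B0 i := if i == k then B0 else B i.
  have mB' B0 : measurable B0 -> forall i, measurable (B' B0 i).
    by move=> mB0 i; rewrite /B'; case: ifP.
  have capE B0 : \bigcap_(i < n) (X i @^-1` B' B0 i) = A `&` X k @^-1` B0.
    apply/seteqP; split => t.
      move=> h; split; last by have := h k kn; rewrite /= /B' eqxx.
      move=> i /= ni; have := h i ni; rewrite /= /B'; case: eqP => // ->.
      by rewrite BT.
    by move=> [h hk] i /= ni; rewrite /B'; case: eqP => [->//|_]; exact: h.
  have PE B0 : measurable B0 -> P (A `&` X k @^-1` B0) = (P A * P (X k @^-1` B0))%E.
    move=> mB0; rewrite -capE (ind _ (mB' _ mB0)) /A (ind _ mB).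
    rewrite [LHS](bigD1 (Ordinal kn))//= [in RHS](bigD1 (Ordinal kn))//=.
    rewrite /B' eqxx BT// preimage_setT probability_setT.
    rewrite mul1e muleC; congr (_ * _)%E; apply: eq_bigr => i.
    by rewrite -val_eqE/= => /negbTE ->.
  have PA1 : P A = (fine (P A))%:E by rewrite fineK// fin_num_measure.
  pose a := fine (P A).
  have a0 : 0 <= a by rewrite fine_ge0.
  pose F1 t : R := if t \in A then \prod_(i < k) f i (X i t) else 0.
  have mF1 : measurable_fun [set: T] F1.
    by apply/(@measurable_restrictT _ _ _ _ A) => //; exact: measurable_funTS.
  have F10 t : 0 <= F1 t by rewrite /F1; case: ifP.
  pose c := (\prod_(i < k) e i) * a.
  have c0 : 0 <= c by rewrite mulr_ge0// prodr_ge0.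
  have := @eq_integral_from_sets R _ _ _ _ _ _ P P (X k) (X k) F1 (fun=> c) (f k)
     (mX k) (mX k) mF1 (measurable_cst _) F10 (fun=> c0) _ (mf k) (f01 k).
  have h B0 : measurable B0 ->
      (\int[P]_(t in X k @^-1` B0) (F1 t)%:E = \int[P]_(t in X k @^-1` B0) c%:E)%E.
    move=> mB0; transitivity (\int[P]_(t in A `&` X k @^-1` B0)
        (\prod_(i < k) f i (X i t))%R%:E)%E.
      rewrite setIC integral_mkcondr; apply: eq_integral => t _.
      by rewrite /patch /F1; case: ifP.
    rewrite -capE IH//; [|exact: ltnW|exact: mB'|]; last first.
      move=> i ik; rewrite /B'; case: eqP => [ik'|_]; first by rewrite ik' ltnn in ik.
      by apply: BT; exact: ltnW.
    rewrite capE PE// integral_cst; last exact: mpre.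
    by rewrite PA1 muleA -EFinM.
  move=> /(_ h) H.
  transitivity (\int[P]_t (F1 t * f k (X k t))%:E)%E.
    rewrite integral_mkcond; apply: eq_integral => t _.
    by rewrite /patch /F1 big_ord_recr/=; case: ifP; rewrite ?mul0r.
  rewrite H; under eq_integral do rewrite EFinM.
  rewrite ge0_integralZl_EFin//; last 2 first.
  - by move=> t _; rewrite lee_fin; case/andP: (f01 k (X k t)).
  - exact/measurable_EFinP.
  by rewrite eE PA1 -!EFinM big_ord_recr/= /c; congr EFin; rewrite -/a; ring.
have := Q n (leqnn n) (fun=> setT) (fun=> measurableT) (fun _ _ => erefl).
have -> : \bigcap_(i < n) (X i @^-1` [set: R]) = [set: T].
  by apply/seteqP; split => // t _ i _.
by rewrite probability_setT mule1 => ->.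
Qed.

End independent_product.

(** * Laws and Levy densities are determined by their exponents *)

Lemma measurable_tail (R : realType) d (T : measurableType d) (X : T -> R)
    (c : R) : measurable_fun [set: T] X -> measurable [set t | c < X t].
Proof.
move=> mX; rewrite (_ : [set t | _] = [set: T] `&` X @^-1` `]c, +oo[).
  exact: mX.
by apply/seteqP; split => t /=; rewrite in_itv/= andbT; [split|case].
Qed.

Lemma cvg_tail0 (R : realType) d (T : measurableType d) (P : probability T R)
    (X : T -> R) : measurable_fun [set: T] X ->
  P [set t | n.+1%:R^-1 < X t] @[n --> \oo] --> P [set t | 0 < X t].
Proof.
move=> mX; rewrite (_ : [set t | 0 < X t] =
    \bigcup_n [set t | n.+1%:R^-1 < X t]); last first.
  apply/seteqP; split => [t /= X0|t [n _ /= nX]]; last first.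
    by apply: lt_trans nX.
  exists (Num.truncn (X t)^-1) => //=.
  by rewrite invf_plt ?posrE// truncnS_gt.
apply: (nondecreasing_cvg_mu (F := fun n => [set t | n.+1%:R^-1 < X t])).
- by move=> n; exact: measurable_tail.
- by apply: bigcup_measurable => n _; exact: measurable_tail.
- move=> m n mn; apply/subsetPset => t /=; apply: le_lt_trans.
  by rewrite lef_pV2 ?posrE// ler_nat ltnS.
Qed.

Section laplace_law.
Context {R : realType} d1 d2 (T1 : measurableType d1) (T2 : measurableType d2).
Variables (P1 : probability T1 R) (P2 : probability T2 R).

Lemma eq_law_of_tails (X1 : T1 -> R) (X2 : T2 -> R) :
  measurable_fun [set: T1] X1 -> measurable_fun [set: T2] X2 ->
  (forall c, P1 [set t | c < X1 t] = P2 [set t | c < X2 t]) ->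
  eq_law P1 X1 P2 X2.
Proof.
move=> mX1 mX2 tails; split => // A mA.
pose Y1 : {mfun T1 >-> R} := HB.pack X1 (isMeasurableFun.Build _ _ _ _ _ mX1).
pose Y2 : {mfun T2 >-> R} := HB.pack X2 (isMeasurableFun.Build _ _ _ _ _ mX2).
have tailE c : [set` `]c, +oo[] = [set x : R | c < x].
  by apply/seteqP; split => x /=; rewrite in_itv/= andbT.
apply: (@measure_unique _ _ _ (@RGenOInfty.G R) (fun n => `]- n%:R, +oo[%classic)
  _ _ _ _ (distribution P1 Y1) (distribution P2 Y2)) => //.
- exact: RGenOInfty.measurableE.
- move=> _ _ [x ->] [y ->]; exists (Num.max x y); rewrite !tailE.
  apply/seteqP; split => z /=; rewrite gt_max; first by move=> [-> ->].
  by move=> /andP[].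
- by move=> n; eexists; reflexivity.
- apply/seteqP; split => // x _; exists (Num.truncn `|x|).+1 => //=.
  rewrite in_itv/= andbT ltrNl; have := truncnS_gt `|x|.
  by have := ler_norm (- x); rewrite normrN; lra.
- by move=> _ [x ->]; rewrite tailE; exact: tails.
- by move=> n; apply: (@le_lt_trans _ _ 1%:E); [exact: probability_le1|exact: ltry].
Qed.

Lemma eq_law_of_laplace (X1 : T1 -> R) (X2 : T2 -> R) :
  measurable_fun [set: T1] X1 -> measurable_fun [set: T2] X2 ->
  (forall t, 0 <= X1 t) -> (forall t, 0 <= X2 t) ->
  (forall u, 0 <= u -> 'E_P1[fun t => expR (- (u * X1 t))]%E =
                       'E_P2[fun t => expR (- (u * X2 t))]%E) ->
  eq_law P1 X1 P2 X2.
Proof.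
move=> mX1 mX2 X10 X20 L; apply: eq_law_of_tails => // c.
have pos_tails : forall c, 0 < c -> P1 [set t | c < X1 t] = P2 [set t | c < X2 t].
  move=> {}c c0.
  have := @laplace_tail_unique R _ _ _ _ P1 P2 setT setT X1 (fun=> 1) X2 (fun=> 1)
    measurableT measurableT mX1 mX2 (fun t _ => X10 t) (fun t _ => X20 t)
    (fun _ _ => ler01) (fun _ _ => ler01) _ _ _ c c0.
  rewrite !setTI !integral_cst//; last 2 first.
  - exact: measurable_tail.
  - exact: measurable_tail.
  rewrite !mul1e; apply.
  - exact: finite_measure_integrable_cst.
  - exact: finite_measure_integrable_cst.
  - move=> u u0; have := L u u0; rewrite unlock => LE.
    under eq_integral do rewrite mul1r.
    by under [RHS]eq_integral do rewrite mul1r.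
have [c0|c0|c0] := ltgtP c 0.
- have -> : [set t | c < X1 t] = setT.
    by apply/seteqP; split => // t _; exact: lt_le_trans (X10 t).
  have -> : [set t | c < X2 t] = setT.
    by apply/seteqP; split => // t _; exact: lt_le_trans (X20 t).
  by rewrite !probability_setT.
- exact: pos_tails.
- rewrite c0; apply: (cvg_unique _ (cvg_tail0 (P := P1) mX1)) => //.
  apply: cvg_trans (cvg_tail0 (P := P2) mX2).
  by apply: near_eq_cvg; apply: nearW => n; rewrite pos_tails.
Qed.

End laplace_law.

(** psi(u + 1) - psi(u) is the Laplace transform of the finite measure with
    density (1 - exp(- s)) rho(s), so the integrals of these densities over
    ]c, +oo[ agree for c > 0. A primitive of the difference of the densities is
    therefore constant on ]0, +oo[, and its derivative is almost everywhere that
    difference. *)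
Lemma levy_density_unique (R : realType) (rho1 rho2 : R -> R) :
  levy_density rho1 -> levy_density rho2 ->
  (forall u, 0 <= u -> levy_exponent rho1 u = levy_exponent rho2 u) ->
  {ae @lebesgue_measure R, forall x : R, 0 < x -> rho1 x = rho2 x}.
Proof.
move=> L1 L2 psiE; pose mu := @lebesgue_measure R.
pose pos := [set` (`]0%R, +oo[ : interval R)].
have mpos : measurable pos by exact: measurable_itv.
have posE (x : R) : pos x = (0 < x) by rewrite /pos/= in_itv/= andbT.
pose g rho (s : R) : R := (1 - expR (- (1 * s))) * rho s.
have ig rho : levy_density rho -> mu.-integrable pos (EFin \o g rho).
  by move=> L; exact: integrable_levy_defect.
have g0 rho s : levy_density rho -> pos s -> 0 <= g rho s.
  by move=> L ps; exact: levy_defect_ge0.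
have gL rho u : levy_density rho -> 0 <= u ->
    (\int[mu]_(s in pos) (g rho s * expR (- (u * s)))%:E =
     (levy_exponent rho (u + 1) - levy_exponent rho u)%:E)%E.
  move=> L u0; rewrite EFinB !levy_exponentE ?addr_ge0// -integralB//=.
  - apply: eq_integral => s _; rewrite -EFinB; congr EFin.
    have -> : - ((u + 1) * s) = - (u * s) + - (1 * s) by ring.
    by rewrite /g expRD; ring.
  - by apply: integrable_levy_defect => //; rewrite addr_ge0.
  - exact: integrable_levy_defect.
have tails (c : R) : 0 < c ->
    (\int[mu]_(s in `]c, +oo[) (g rho1 s)%:E =
     \int[mu]_(s in `]c, +oo[) (g rho2 s)%:E)%E.
  move=> c0.
  have id0 (t : R) : pos t -> 0 <= t by rewrite posE => /ltW.
  have mid : measurable_fun pos (fun t : R => t) by exact: measurable_id.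
  have LE (u : R) : 0 <= u ->
      (\int[mu]_(t in pos) (g rho1 t * expR (- (u * t)))%:E =
       \int[mu]_(t in pos) (g rho2 t * expR (- (u * t)))%:E)%E.
    by move=> u0; rewrite !gL// !psiE// addr_ge0.
  have := @laplace_tail_unique R _ _ _ _ mu mu pos pos (fun t : R => t) (g rho1)
    (fun t : R => t) (g rho2) mpos mpos mid mid
    id0 id0 (fun t => g0 _ t L1) (fun t => g0 _ t L2) (ig _ L1) (ig _ L2) LE c c0.
  have -> // : pos `&` [set t : R | (c < t)%R] = [set` `]c, +oo[].
  apply/seteqP; split => x /=; rewrite !in_itv/= !andbT; first by case.
  by move=> cx; split; [rewrite posE; exact: lt_trans c0 cx|exact: cx].
pose f (s : R) : R := g rho1 s - g rho2 s.
have if_ : mu.-integrable pos (EFin \o f).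
  have := @integrableB _ _ _ mu pos mpos _ _ (ig _ L1) (ig _ L2).
  by apply: eq_integrable => // s _.
pose h := f \_ pos.
have locf : locally_integrable [set: R] h by exact: integrable_locally.
have ih : mu.-integrable [set: R] (EFin \o h).
  by have := @integrable_mkcond _ _ _ mu pos (EFin \o f) mpos; rewrite restrict_EFin => <-.
have ihS (D : set R) : measurable D -> mu.-integrable D (EFin \o h).
  by move=> mD; apply: integrableS ih.
have htail (c : R) : 0 < c -> (\int[mu]_(s in `]c, +oo[) (h s)%:E = 0)%E.
  move=> c0.
  have cpos : [set` `]c, +oo[] `<=` pos.
    by move=> x; rewrite posE /= in_itv/= andbT; exact: lt_trans.
  transitivity (\int[mu]_(s in `]c, +oo[) ((g rho1 s)%:E - (g rho2 s)%:E))%E.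
    apply: eq_integral => s; rewrite inE => cs.
    by rewrite -EFinB /h /patch mem_set//; exact: cpos.
  have i1 : mu.-integrable `]c, +oo[ (EFin \o g rho1).
    by apply: integrableS (ig _ L1).
  have i2 : mu.-integrable `]c, +oo[ (EFin \o g rho2).
    by apply: integrableS (ig _ L2).
  rewrite integralB// tails// subee//.
  exact: integrable_fin_num.
pose F (x : R) : R := \int[mu]_(t in `]-oo, x]) h t.
have Fcst (x : R) : 0 < x -> F x = \int[mu]_t h t.
  move=> x0; rewrite -(setUv [set` `]-oo, x]]) Rintegral_setU.
  - by rewrite setCitvl /F [X in _ + X]/Rintegral htail// addr0.
  - exact: measurable_itv.
  - by apply: measurableC; exact: measurable_itv.
  - by rewrite setUv.
  - by apply/disj_set2P; rewrite setICr.
have : {ae mu, forall x, derivable F x 1 /\ derive1 F x = h x}.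
  by apply: FTC1Ny => // y; exact: ihS.
apply: filterS; first exact: (ae_filter_ringOfSetsType mu).
move=> x [_ F'] x0.
have : derive1 F x = 0.
  rewrite derive1E (@near_eq_derive _ _ _ F (cst (\int[mu]_t h t))).
    exact: derive_cst.
  by near=> y; apply: Fcst; near: y; exact: lt_nbhsr.
rewrite F' /h /patch mem_set ?posE// /f /g -mulrBr => /eqP.
have e1 : expR (- (1 * x)) < 1 by rewrite expR_lt1; lra.
rewrite mulf_eq0 subr_eq0 (gt_eqF e1)/=.
by rewrite subr_eq0 => /eqP.
Unshelve. all: by end_near. Qed.

(** * Riemann sums against a measure *)

Section riemann_sums.
Context {R : realType}.

Lemma uniformly_continuous_segment (f : R -> R) (a b e : R) :
  continuous f -> 0 < e ->
  exists2 d, 0 < d & forall x y, a <= x <= b -> `|x - y| < d -> `|f x - f y| < e.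
Proof.
move=> cf e0.
have /compact_near_coveringP K := @segment_compact R a b.
pose Q (d x : R) := forall y, `|x - y| < d -> `|f x - f y| < e.
have := K R (0^'+) Q _; case.
  move=> x _; have /cvgrPdist_lt /(_ (e / 2)) := cf x.
  rewrite divr_gt0// => /(_ isT) [r /= r0 xr].
  exists (ball x (r / 2), [set d | d < r / 2]).
    split => /=; first by apply: nbhsx_ballx; rewrite divr_gt0.
    by apply: nbhs_right_lt; rewrite divr_gt0.
  move=> [x' d] [/= xx' dr] y x'y.
  have h1 := xr _ (lt_trans xx' _).
  have h2 := xr y.
  have : `|f x - f x'| < e / 2 by apply: h1; lra.
  have : `|f x - f y| < e / 2.
    apply: h2; rewrite /ball/= in xx' *.
    have := ler_distD x' x y; lra.
  have := ler_distD (f x) (f x') (f y); rewrite (distrC (f x') (f x)); lra.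
move=> d /= d0 dQ; exists (d / 2); first by rewrite divr_gt0.
move=> x y xab; apply: (dQ (d / 2) _ _ x) => /=.
- by rewrite sub0r normrN gtr0_norm ?divr_gt0//; lra.
- by rewrite divr_gt0.
- by rewrite in_itv.
Qed.

Variable mu : {measure set (measurableTypeR R) -> \bar R}.

Lemma partition_sum_approx (f : R -> R) (p : nat -> R) (e : R) (n : nat) :
  (forall i, p i <= p i.+1) ->
  (forall k, mu [set` `]p 0%N, p k]] < +oo)%E ->
  (forall k, mu.-integrable [set` `]p 0%N, p k]] (EFin \o f)) ->
  (forall i s, (i < n)%N -> p i < s -> s <= p i.+1 ->
     `|f (p i.+1) - f s| <= e) ->
  forall k, (k <= n)%N -> `|\sum_(i < k) f (p i.+1) * fine (mu [set` `]p i, p i.+1]]) -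
     \int[mu]_(s in [set` `]p 0%N, p k]]) f s| <= e * fine (mu [set` `]p 0%N, p k]]).
Proof.
move=> ndp fmu fint mesh; elim => [_|k IH kn].
  rewrite big_ord0 sub0r normrN set_itv_ge ?bnd_simp ?ltxx//.
  by rewrite Rintegral_set0 normr0 measure0 mulr0.
have p0k : p 0%N <= p k.
  by elim: k {IH kn} => // k IH; exact: le_trans (ndp k).
have UE : [set` `]p 0%N, p k.+1]] = [set` `]p 0%N, p k]] `|` [set` `]p k, p k.+1]].
  by rewrite -itv_bndbnd_setU// bnd_simp.
have disj : [set` `]p 0%N, p k]] `&` [set` `]p k, p k.+1]] = set0.
  by apply/seteqP; split => // s [/=]; rewrite !in_itv/=; lra.
have sub : [set` `]p k, p k.+1]] `<=` [set` `]p 0%N, p k.+1]].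
  by rewrite UE; exact: subsetUr.
have mfin : mu [set` `]p k, p k.+1]] \is a fin_num.
  rewrite ge0_fin_numE//; apply: le_lt_trans (fmu k.+1).
  by apply: le_measure; rewrite ?inE//; exact: measurable_itv.
have muE : fine (mu [set` `]p 0%N, p k.+1]]) =
    fine (mu [set` `]p 0%N, p k]]) + fine (mu [set` `]p k, p k.+1]]).
  rewrite UE measureU//; try exact: measurable_itv.
  by rewrite fineD// ge0_fin_numE// fmu.
have intE : \int[mu]_(s in [set` `]p 0%N, p k.+1]]) f s =
    \int[mu]_(s in [set` `]p 0%N, p k]]) f s + \int[mu]_(s in [set` `]p k, p k.+1]]) f s.
  rewrite UE Rintegral_setU//; try exact: measurable_itv.
  - by rewrite -UE; exact: fint.
  - by apply/disj_set2P.
have ik : mu.-integrable [set` `]p k, p k.+1]] (EFin \o f).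
  by apply: integrableS (fint k.+1) => //; exact: measurable_itv.
have icst (r : R) : mu.-integrable [set` `]p k, p k.+1]] (EFin \o cst r).
  apply: (@measurable_bounded_integrable _ _ _ mu (cst r) _ (measurable_itv _)).
  - by rewrite -ge0_fin_numE.
  - exact: measurable_cst.
  - by exists `|r|; split => // M rM s _ /=; exact: ltW.
have cell : `|f (p k.+1) * fine (mu [set` `]p k, p k.+1]]) -
    \int[mu]_(s in [set` `]p k, p k.+1]]) f s| <= e * fine (mu [set` `]p k, p k.+1]]).
  rewrite -!(@Rintegral_cst _ _ _ mu [set` `]p k, p k.+1]]); try exact: measurable_itv.
  rewrite -RintegralB//; last exact: icst.
  apply: (le_trans (le_normr_Rintegral _ _)); first exact: measurable_itv.
    by apply: (@integrableB _ _ _ mu _ _ (EFin \o cst (f (p k.+1))) (EFin \o f)).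
  apply: le_Rintegral; first exact: measurable_itv.
  - apply: (@integrable_norm _ _ _ mu _ (fun x => cst (f (p k.+1)) x - f x)).
    by apply: (@integrableB _ _ _ mu _ _ (EFin \o cst (f (p k.+1))) (EFin \o f)).
  - exact: icst.
  - by move=> s /=; rewrite in_itv/= => /andP[ps sp]; exact: (mesh k s kn).
rewrite big_ord_recr/= intE muE mulrDr.
set S := \sum_(i < k) _ in IH *.
apply: le_trans (lerD (IH (ltnW kn)) cell).
by apply: le_trans (ler_normD _ _); rewrite opprD addrACA.
Qed.

Definition uniform_grid (t : R) (n i : nat) : R := t * (i%:R / n.+1%:R).

Lemma uniform_grid_le (t : R) n i : 0 <= t ->
  uniform_grid t n i <= uniform_grid t n i.+1.
Proof.
by move=> t0; rewrite ler_wpM2l// ler_wpM2r ?invr_ge0// ler_nat.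
Qed.

Lemma uniform_grid0 (t : R) n : uniform_grid t n 0 = 0.
Proof. by rewrite /uniform_grid mul0r mulr0. Qed.

Lemma uniform_grid_last (t : R) n : uniform_grid t n n.+1 = t.
Proof. by rewrite /uniform_grid divff ?mulr1. Qed.

Lemma uniform_gridB (t : R) n i :
  uniform_grid t n i.+1 - uniform_grid t n i = t / n.+1%:R.
Proof.
by rewrite /uniform_grid -mulrBr -mulrBl -natr1 addrAC subrr add0r mul1r.
Qed.

Lemma uniform_grid_ge0 (t : R) n i : 0 <= t -> 0 <= uniform_grid t n i.
Proof. by move=> t0; rewrite !mulr_ge0 ?invr_ge0. Qed.

(** Stated for an arbitrary measure because it is used twice: for the random
    measure of a path, and for Lebesgue measure on the exponents of the
    corresponding Laplace transforms. *)
Lemma cvg_riemann_sum (f : R -> R) (t : R) : continuous f -> 0 <= t ->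
  (forall b, mu [set` `]0%R, b]] < +oo)%E ->
  \sum_(i < n.+1) f (uniform_grid t n i.+1) *
    fine (mu [set` `]uniform_grid t n i, uniform_grid t n i.+1]]) @[n --> \oo] -->
  \int[mu]_(s in [set` `]0, t]]) f s.
Proof.
move=> cf t0 fmu.
have fint b : mu.-integrable [set` `]0, b]] (EFin \o f).
  have [M [_ Mf]] : bounded_set (f @` `[0, b]).
    apply: compact_bounded; apply: continuous_compact; last exact: segment_compact.
    exact: continuous_subspaceT.
  apply: measurable_bounded_integrable; [exact: measurable_itv|exact: fmu| |].
  - by apply: measurable_funTS; exact: continuous_measurable_fun.
  - exists M; split; first exact: num_real.
    move=> N MN s /= sb; apply: (Mf N MN); exists s => //=.
    by move: sb; rewrite !in_itv/= => /andP[/ltW -> ->].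
apply/cvgrPdist_le => e e0.
pose m := fine (mu [set` `]0%R, t]]).
have m0 : 0 <= m by rewrite fine_ge0.
pose e' := e / (m + 1).
have m1 : 0 < m + 1 by lra.
have e'0 : 0 < e' by rewrite divr_gt0.
have [d d0 fd] := uniformly_continuous_segment 0 t cf e'0.
near=> n.
have td : t / n.+1%:R < d.
  rewrite ltr_pdivrMr// mulrC -ltr_pdivrMr//.
  apply: (@lt_trans _ _ n%:R); last by rewrite ltr_nat.
  by near: n; exact: nbhs_infty_gtr.
have H := @partition_sum_approx f (uniform_grid t n) e' n.+1
  (fun i => uniform_grid_le n i t0).
rewrite uniform_grid0 in H.
have {}H := H (fun k => fmu _) (fun k => fint _) _ n.+1 (leqnn _).
rewrite uniform_grid_last in H.
rewrite distrC; apply: le_trans (H _) _.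
  move=> i s ni gs sg; apply/ltW/fd.
    rewrite uniform_grid_ge0//= -[leRHS](uniform_grid_last t n).
    by rewrite ler_wpM2l// ler_wpM2r ?invr_ge0// ler_nat.
  have gB := uniform_gridB t n i.
  rewrite ger0_norm ?subr_ge0//; move: gB gs td.
  set x := uniform_grid t n i.+1; set y := uniform_grid t n i; set z := t / _.
  by move=> ? ? ?; lra.
rewrite -/m /e' mulrAC ler_pdivrMr//; apply: ler_wpM2l; first exact: ltW.
by lra.
Unshelve. all: by end_near. Qed.

End riemann_sums.

(** * Laplace transforms of integrals against a subordinator *)

Section laplace_functional.
Context {R : realType} d (T : measurableType d) (P : probability T R).
Variables (X : increasing_process R T) (rho : R -> R).
Hypothesis subX : subordinator P X rho.
Local Notation leb := (@lebesgue_measure R).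

Lemma path_measure_itv (w : T) (a b : R) : 0 <= a -> a <= b ->
  path_measure X w [set` `]a, b]] = (X b w - X a w)%:E.
Proof.
move=> a0 ab; rewrite /path_measure /lebesgue_stieltjes_measure /measure_extension.
rewrite measurable_mu_extE/=; last exact: is_ocitv.
rewrite wlength_itv_bnd// /path_ext !(max_idPr _)//.
exact: le_trans ab.
Qed.

Lemma path_measure_fin (w : T) (b : R) :
  (path_measure X w [set` `]0%R, b]] < +oo)%E.
Proof.
have [b0|b0] := leP 0 b; first by rewrite path_measure_itv// ltry.
by rewrite set_itv_ge ?measure0// bnd_simp -leNgt ltW.
Qed.

Lemma process_ge0 (t : R) (w : T) : 0 <= t -> 0 <= X t w.
Proof. by move=> t0; rewrite -(ip_start X w); exact: ip_nondecreasing. Qed.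

Lemma laplace_increment (s t v : R) : 0 <= s -> 0 <= t -> 0 <= v ->
  (\int[P]_w (expR (- (v * (X (s + t) w - X s w))))%:E =
   (expR (- (t * levy_exponent rho v)))%:E)%E.
Proof.
move=> s0 t0 v0; case: subX => stat _ _ lapX.
pose g (x : R) : R := expR (- (v * Num.max 0 x)).
have mg : measurable_fun [set: R] g.
  by apply: measurable_expRNM => //; exact: measurable_maxr.
have g01 x : 0 <= g x <= 1.
  by rewrite expR_ge0/= -expR0 ler_expR oppr_le0 mulr_ge0// le_max lexx.
have := eq_law_integral (stat s t s0 t0) mg g01.
have -> : (\int[P]_w (g (X (s + t) w - X s w))%:E =
    \int[P]_w (expR (- (v * (X (s + t) w - X s w))))%:E)%E.
  apply: eq_integral => w _; rewrite /g (max_idPr _)// subr_ge0.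
  by apply: ip_nondecreasing => //; rewrite lerDl.
have := lapX t v t0 v0; rewrite unlock => <- ->; apply: eq_integral => w _.
by rewrite /g ip_start subr0 (max_idPr _)// process_ge0.
Qed.

Variables (f : R -> R) (t : R).
Hypothesis cf : continuous f.
Hypothesis f0 : forall s, 0 <= f s.
Hypothesis t0 : 0 <= t.

Let grid := uniform_grid t.

Let S n w : R := \sum_(i < n.+1) f (grid n i.+1) *
  (X (grid n i.+1) w - X (grid n i) w).

Let inc_ge0 n i w : 0 <= X (grid n i.+1) w - X (grid n i) w.
Proof.
rewrite subr_ge0; apply: ip_nondecreasing; first exact: uniform_grid_ge0.
exact: uniform_grid_le.
Qed.

Let minc n i : measurable_fun [set: T]
  (fun w => X (grid n i.+1) w - X (grid n i) w).
Proof.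
by apply: measurable_funB; apply: ip_measurable; exact: uniform_grid_ge0.
Qed.

Let cvgS w : S n w @[n --> \oo] --> \int[path_measure X w]_(s in `]0, t]) f s.
Proof.
have := cvg_riemann_sum (mu := path_measure X w) cf t0 (path_measure_fin w).
apply: cvg_trans; apply: near_eq_cvg; apply: nearW => n.
apply: eq_bigr => i _; congr (_ * _).
have := path_measure_itv w (uniform_grid_ge0 n i t0) (uniform_grid_le n i t0).
by move=> /(congr1 fine) ->.
Qed.

Let mS n : measurable_fun [set: T] (S n).
Proof. by apply: measurable_sum => i; exact: measurable_funM. Qed.

Lemma measurable_path_integral :
  measurable_fun [set: T] (fun w => \int[path_measure X w]_(s in `]0, t]) f s).
Proof. by apply: (measurable_fun_cvg mS) => w _; exact: cvgS. Qed.

Let laplace_S (u : R) n : 0 <= u ->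
  (\int[P]_w (expR (- (u * S n w)))%:E =
   (expR (- \sum_(i < n.+1) levy_exponent_ext rho (u * f (grid n i.+1)) *
      fine (leb [set` `]grid n i, grid n i.+1]]) ))%:E)%E.
Proof.
move=> u0; case: (subX) => _ indX _ _.
pose g (i : nat) (x : R) : R := expR (- (u * f (grid n i.+1) * Num.max 0 x)).
have uf i : 0 <= u * f (grid n i.+1) by rewrite mulr_ge0.
have mg i : measurable_fun [set: R] (g i).
  by apply: measurable_expRNM => //; exact: measurable_maxr.
have g01 i x : 0 <= g i x <= 1.
  by rewrite expR_ge0/= -expR0 ler_expR oppr_le0 mulr_ge0// le_max lexx.
have gE i w : g i (X (grid n i.+1) w - X (grid n i) w) =
    expR (- (u * f (grid n i.+1) * (X (grid n i.+1) w - X (grid n i) w))).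
  by rewrite /g (max_idPr _).
have ind B : (forall i, measurable (B i)) -> P (\bigcap_(i < n.+1)
    ((fun w => X (grid n i.+1) w - X (grid n i) w) @^-1` B i)) =
    (\prod_(i < n.+1) P ((fun w => (X (grid n i.+1) w - X (grid n i) w)%R) @^-1` B i))%E.
  move=> mB; apply: (indX n.+1 (grid n) B) => //.
  - by rewrite /grid uniform_grid0.
  - by move=> i; exact: uniform_grid_le.
have := expectation_prod_independent (minc n) ind mg g01.
rewrite unlock => H; transitivity (\int[P]_w (\prod_(i < n.+1)
    g i (X (grid n i.+1) w - X (grid n i) w))%R%:E)%E.
  apply: eq_integral => w _; congr EFin.
  rewrite /S mulr_sumr -sumrN expR_sum; apply: eq_bigr => i _.
  by rewrite gE mulrA.
rewrite H; congr EFin; rewrite -sumrN expR_sum; apply: eq_bigr => i _.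
have gridD : grid n i.+1 = grid n i + t / n.+1%:R.
  by rewrite -(uniform_gridB t n i) addrC subrK.
have -> : (\int[P]_w (g i (X (grid n i.+1) w - X (grid n i) w)%R)%:E =
  (expR (- (t / n.+1%:R * levy_exponent rho (u * f (grid n i.+1)))))%:E)%E.
  have tn : 0 <= t / n.+1%:R by rewrite divr_ge0.
  have := laplace_increment (uniform_grid_ge0 n i t0) tn (uf i).
  move=> <-; by apply: eq_integral => w _; rewrite gE -gridD.
rewrite /= levy_exponent_extE// lebesgue_measure_itv/= lte_fin; congr (expR (- _)).
case: ltP => gg; first by rewrite -EFinB/= uniform_gridB mulrC.
have : t / n.+1%:R = 0.
  apply/eqP; rewrite eq_le divr_ge0// andbT.
  by move: gg; rewrite gridD gerDl.
by move=> ->; rewrite mulr0 mul0r.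
Qed.

(** For a Riemann sum of the path integral, independence and stationarity of the
    increments turn the Laplace transform into the exponential of minus the
    Riemann sum of psi(u f(s)); both sides pass to the limit, the left one by
    dominated convergence. *)
Lemma laplace_path_integral (u : R) : 0 <= u ->
  (\int[P]_w (expR (- (u * (\int[path_measure X w]_(s in `]0, t]) f s)%R)))%:E =
   (expR (- (\int[leb]_(s in `]0, t]) levy_exponent_ext rho (u * f s))%R))%:E)%E.
Proof.
move=> u0; case: (subX) => _ _ Lrho _.
have cpsi : continuous (fun s => levy_exponent_ext rho (u * f s)).
  move=> s; apply: (@continuous_comp _ _ _ (fun s => u * f s) (levy_exponent_ext rho));
    last exact: continuous_levy_exponent_ext.
  by apply: cvgMr; exact: cf.
have lebfin (b : R) : (leb [set` `]0%R, b]] < +oo)%E.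
  by rewrite lebesgue_measure_itv/=; case: ifP => _; rewrite ?ltry// -EFinB ltry.
have c1 := cvg_riemann_sum (mu := leb) cpsi t0 lebfin.
have c2 : ((expR (- \sum_(i < n.+1) levy_exponent_ext rho (u * f (grid n i.+1)) *
      fine (leb [set` `]grid n i, grid n i.+1]])))%:E @[n --> \oo] -->
   (expR (- \int[leb]_(s in `]0, t]) levy_exponent_ext rho (u * f s)))%:E)%E.
  apply: cvg_EFin; first exact: nearW.
  by apply: continuous_cvg; [exact: continuous_expR|exact: cvgN].
have [] // := @dominated_convergence _ _ _ P setT measurableT
  (fun n w => (expR (- (u * S n w)))%:E)
  (fun w => (expR (- (u * (\int[path_measure X w]_(s in `]0, t]) f s)%R)))%:E)
  (cst 1%:E).
- by move=> n; apply/measurable_EFinP; exact: measurable_expRNM.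
- apply/measurable_EFinP; apply: measurable_expRNM => //.
  exact: measurable_path_integral.
- apply: aeW => w _; apply: cvg_EFin; first exact: nearW.
  apply: continuous_cvg; first exact: continuous_expR.
  by apply: cvgN; apply: cvgMr; exact: cvgS.
- exact: finite_measure_integrable_cst.
- apply: aeW => w n _ /=; rewrite lee_fin ger0_norm ?expR_ge0//.
  rewrite -expR0 ler_expR oppr_le0 mulr_ge0// sumr_ge0// => i _.
  by rewrite mulr_ge0.
move=> _ _ c3; apply: (cvg_unique _ c3) => //.
apply: cvg_trans c2; apply: near_eq_cvg; apply: nearW => n.
exact/esym/laplace_S.
Qed.

End laplace_functional.

(** * The exponents of the clocks and of the stationary Ornstein-Uhlenbeck law *)

Section clock_exponents.
Context {R : realType}.
Local Notation leb := (@lebesgue_measure R).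
Variable rho : R -> R.
Hypothesis sd : self_decomposable rho.
Hypothesis drho : forall x, 0 < x -> derivable rho x 1.
Hypothesis Lrho : levy_density rho.
Local Notation rhoZ := (fun x => - (x * derive1 rho x)).
Hypothesis LZ : levy_density rhoZ.
Local Notation psi := (levy_exponent rho).
Local Notation psiZ := (levy_exponent_ext rhoZ).

Let integrable_psiZ (g : R -> R) (a b : R) : continuous g ->
  leb.-integrable `[a, b] (EFin \o (psiZ \o g)).
Proof.
move=> cg; apply: continuous_compact_integrable; first exact: segment_compact.
apply: continuous_subspaceT => x.
apply: (@continuous_comp _ _ _ g psiZ); first exact: cg.
exact: continuous_levy_exponent_ext.
Qed.

Let integral_psiZ_oc (g : R -> R) (a b : R) : continuous g ->
  \int[leb]_(s in `]a, b]) psiZ (g s) = \int[leb]_(s in `[a, b]) psiZ (g s).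
Proof.
move=> cg; apply: Rintegral_itv_obnd_cbnd.
apply: (@integrableS _ _ _ leb `[a, b]); try exact: measurable_itv.
  exact: subset_itv_oc_cc.
exact: integrable_psiZ.
Qed.

Lemma continuous_quantile_kernel (t : R) :
  continuous (fun s : R => Num.max 0 (1 - s / t)).
Proof.
move=> s.
apply: (@continuous_max R R (fun=> 0) (fun s => 1 - s / t) s); first exact: cvg_cst.
by apply: cvgB; [exact: cvg_cst|apply: cvgMl; exact: cvg_id].
Qed.

(** The kernel is a ramp of slope 1 / t and length t. *)
Lemma quantile_clock_exponent (t u : R) : 0 <= t -> 0 <= u ->
  \int[leb]_(s in `]0, t]) psiZ (u * Num.max 0 (1 - s / t)) = t * psi u.
Proof.
rewrite le_eqVlt => /predU1P[<- _|t0 u0].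
  by rewrite set_itv_ge ?bnd_simp ?ltxx// Rintegral_set0 mul0r.
rewrite (integral_psiZ_oc (g := fun s => u * Num.max 0 (1 - s / t))); last first.
  by move=> s; apply: cvgMr; exact: continuous_quantile_kernel.
transitivity (\int[leb]_(s in `[0, t]) psiZ (u / t * (t - s))).
  apply: eq_Rintegral => s; rewrite inE/= in_itv/= => /andP[s0 st].
  congr psiZ; rewrite (max_idPr _); last first.
    by rewrite subr_ge0 ler_pdivrMr// mul1r.
  by field; rewrite gt_eqF.
have c0 : 0 <= u / t by rewrite divr_ge0// ltW.
apply: etrans (Rintegral_levy_exponent_ramp sd drho Lrho LZ (ltW t0) c0) _.
by rewrite subr0 divfK// gt_eqF.
Qed.

Variable eps : R.
Hypothesis eps0 : 0 < eps.

Local Notation kernel t := (fun s : R => Num.min 1 (Num.max 0 (t - s) / eps)).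

Lemma continuous_short_memory_kernel (t : R) : continuous (kernel t).
Proof.
move=> s; apply: (@continuous_min R R (fun=> 1) (fun s => Num.max 0 (t - s) / eps) s).
  exact: cvg_cst.
apply: cvgMl; apply: (@continuous_max R R (fun=> 0) (fun s => t - s) s).
  exact: cvg_cst.
by apply: cvgB; [exact: cvg_cst|exact: cvg_id].
Qed.

Lemma short_memory_kernel_ge0 (t s : R) : 0 <= kernel t s.
Proof. by rewrite le_min ler01 divr_ge0 ?(ltW eps0)// le_max lexx. Qed.

(** The kernel is a ramp of slope 1 / eps on the last eps units of time, or on
    all of ]0, t] when t <= eps, and 1 before. *)
Lemma short_memory_exponent (t u : R) : 0 <= t -> 0 <= u ->
  \int[leb]_(s in `]0, t]) psiZ (u * kernel t s) =
  if t <= eps then t * psi (u * (t / eps))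
  else eps * psi u + (t - eps) * psiZ u.
Proof.
move=> t0 u0.
have cg : continuous (fun s => u * kernel t s).
  by move=> s; apply: cvgMr; exact: continuous_short_memory_kernel.
have ramp (a : R) : a <= t -> t - eps <= a ->
    \int[leb]_(s in `[a, t]) psiZ (u * kernel t s) =
    (t - a) * psi (u * ((t - a) / eps)).
  move=> at_ ta; transitivity (\int[leb]_(s in `[a, t]) psiZ (u / eps * (t - s))).
    apply: eq_Rintegral => s; rewrite inE/= in_itv/= => /andP[as_ st].
    congr psiZ; rewrite (max_idPr _) ?subr_ge0// (min_idPr _).
      by field; rewrite gt_eqF.
    by rewrite ler_pdivrMr//; lra.
  have c0 : 0 <= u / eps by rewrite divr_ge0// ltW.
  apply: etrans (Rintegral_levy_exponent_ramp sd drho Lrho LZ at_ c0) _.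
  by rewrite -!mulrA (mulrC eps^-1).
rewrite (integral_psiZ_oc (g := fun s => u * kernel t s))//.
case: ifPn => [te|]; first by rewrite ramp ?subr0//; lra.
rewrite -ltNge => et.
have := @Rintegral_itvB R (fun s => psiZ (u * kernel t s)) (BLeft 0) (BRight t)
  (t - eps).
rewrite !bnd_simp => /(_ (integrable_psiZ _ _ cg)).
have te0 : 0 <= t - eps by rewrite subr_ge0 ltW.
have tet : t - eps <= t by rewrite gerBl ltW.
move=> /(_ te0 tet) /eqP; rewrite subr_eq => /eqP ->.
rewrite (integral_psiZ_oc (g := fun s => u * kernel t s))// ramp//.
have -> : t - (t - eps) = eps by ring.
rewrite divff ?gt_eqF// mulr1; congr (_ + _).
transitivity (\int[leb]_(s in `[0, t - eps]) (cst (psiZ u) s)).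
  apply: eq_Rintegral => s; rewrite inE/= in_itv/= => /andP[s0 st].
  congr psiZ; rewrite (min_idPl _) ?mulr1// ler_pdivlMr// mul1r.
  by rewrite le_max; apply/orP; right; lra.
have lebE : (leb [set` `[0%R, (t - eps)%R]] = (t - eps)%:E)%E.
  by rewrite lebesgue_measure_itv/= lte_fin subr_gt0 et sube0.
by rewrite Rintegral_cst// [X in _ * fine X]lebE/= mulrC.
Qed.

End clock_exponents.

Section OU_exponent.
Context {R : realType} d (T : measurableType d) (P : probability T R).
Local Notation leb := (@lebesgue_measure R).
Variables (zeta theta : increasing_process R T) (rho rhoT : R -> R).
Hypothesis zeta_sub : subordinator P zeta rho.
Hypothesis theta_sub : subordinator P theta rhoT.
Hypothesis OU : OU_BDLP P zeta theta.

Let expN_cont : continuous (fun s : R => expR (- s)).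
Proof.
move=> s; apply: continuous_comp; first exact: opp_continuous.
exact: continuous_expR.
Qed.

Let V (n : nat) w : R := \int[path_measure theta w]_(s in `]0, n%:R]) expR (- s).

Let VE n w : ((V n w)%:E =
  \int[path_measure theta w]_(s in `]0%R, n%:R]) (expR (- s))%:E)%E.
Proof.
rewrite /V /Rintegral fineK//; apply: integrable_fin_num.
  exact: measurable_itv.
apply: (@measurable_bounded_integrable _ _ _ (path_measure theta w) _ _
  (measurable_itv _)).
- exact: path_measure_fin.
- by apply: measurable_funTS; exact: continuous_measurable_fun.
- exists 1; split => // M M1 s /=; rewrite in_itv/= => /andP[s0 _].
  rewrite ger0_norm ?expR_ge0// (le_trans _ (ltW M1))// -expR0 ler_expR.
  by rewrite oppr_le0 ltW.
Qed.

Let cvgV w : ((V n w)%:E @[n --> \oo] --> OU_stationary theta w)%E.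
Proof.
under eq_fun do rewrite VE.
rewrite /OU_stationary.
have -> : [set` (`]0%R, +oo[ : interval R)] =
    \bigcup_(n : nat) [set` (`]0%R, n%:R] : interval R)].
  by rewrite itv_bndy_bigcup_BRight; apply: eq_bigcupr => n _; rewrite add0r.
apply: ge0_nondecreasing_set_cvg_integral.
- move=> n k nk; apply/subsetPset => s /=; rewrite !in_itv/= => /andP[-> /=].
  by move=> /le_trans; apply; rewrite ler_nat.
- by move=> n; exact: measurable_itv.
- move=> n; apply/measurable_EFinP; apply: measurable_funTS.
  exact: continuous_measurable_fun.
- by move=> n s _; rewrite lee_fin expR_ge0.
Qed.

(** The stationary variable has the law of zeta(1), which is real. *)
Lemma OU_stationary_fin : {ae P, forall w, OU_stationary theta w \is a fin_num}.
Proof.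
have [mz mV lawE] := OU.
have V0 w : (0 <= OU_stationary theta w)%E.
  by apply: integral_ge0 => s _; rewrite lee_fin expR_ge0.
exists (OU_stationary theta @^-1` [set +oo%E]); split.
- by rewrite -[X in measurable X]setTI; apply: mV.
- rewrite -lawE//.
  rewrite (_ : _ @^-1` _ = set0) ?measure0//.
  by apply/seteqP; split.
- move=> w /= /negP; rewrite ge0_fin_numE// -leNgt leye_eq => /eqP //.
Qed.

(** The integrals V n of exp(- s) over ]0, n] increase to the stationary
    variable. Their Laplace transforms are given by [laplace_path_integral], and
    the limit has the law of zeta(1), whose exponent is psi. *)
Lemma cvg_OU_exponent (u : R) : 0 < u ->
  \int[leb]_(s in `[0, n%:R]) levy_exponent_ext rhoT (u * expR (- s))
    @[n --> \oo] --> levy_exponent rho u.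
Proof.
move=> u0; have [_ mV _] := OU.
have [_ _ _ lapz] := zeta_sub.
have [_ _ LT _] := theta_sub.
(* the maximum with 0 only makes g bounded by 1 on all extended reals *)
pose g (x : \bar R) : R := expR (- (u * Num.max 0 (fine x))).
have mg : measurable_fun [set: \bar R] g.
  apply: measurable_expRNM; first exact: measurable_cst.
  apply: measurable_maxr; first exact: measurable_cst.
  exact: fine_measurable.
have g01 x : 0 <= g x <= 1.
  by rewrite expR_ge0/= -expR0 ler_expR oppr_le0 mulr_ge0 ?(ltW u0)// le_max lexx.
have V0 n w : 0 <= V n w by apply: Rintegral_ge0.
have gV : (\int[P]_w (g (OU_stationary theta w))%:E =
    (expR (- levy_exponent rho u))%:E)%E.
  rewrite -(eq_law_integral OU mg g01).
  have := lapz 1 u ler01 (ltW u0); rewrite mul1r unlock => <-.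
  apply: eq_integral => w _; rewrite /g /= (max_idPr _)//.
  exact: process_ge0.
have [] // := @dominated_convergence _ _ _ P setT measurableT
  (fun n w => (expR (- (u * V n w)))%:E)
  (fun w => (g (OU_stationary theta w))%:E) (cst 1%:E).
- move=> n; apply/measurable_EFinP; apply: measurable_expRNM => //.
  apply: measurable_path_integral => //.
- by apply/measurable_EFinP; exact: measurableT_comp.
- apply: filterS OU_stationary_fin => w Vfin _.
  apply: cvg_EFin; first exact: nearW.
  rewrite /g; apply: continuous_cvg; first exact: continuous_expR.
  apply: cvgN; apply: cvgMr.
  have := @cvgV w; rewrite -(fineK Vfin) => /fine_cvg /= c.
  rewrite (max_idPr _)//.
  by apply: fine_ge0; apply: integral_ge0 => s _; rewrite lee_fin expR_ge0.
- exact: finite_measure_integrable_cst.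
- apply: aeW => w n _ /=; rewrite lee_fin ger0_norm ?expR_ge0//.
  by rewrite -expR0 ler_expR oppr_le0 mulr_ge0// ltW.
move=> _ _; rewrite gV => c.
pose I n := \int[leb]_(s in `[0, n%:R]) levy_exponent_ext rhoT (u * expR (- s)).
have cu : continuous (fun s : R => u * expR (- s)).
  by move=> s; apply: cvgMr; exact: expN_cont.
have cI : continuous (fun s : R => levy_exponent_ext rhoT (u * expR (- s))).
  move=> s; apply: (@continuous_comp _ _ _ (fun s : R => u * expR (- s))
    (levy_exponent_ext rhoT)); first exact: cu.
  exact: continuous_levy_exponent_ext.
have c' : expR (- I n) @[n --> \oo] --> expR (- levy_exponent rho u).
  rewrite (_ : (fun n => _) = fine \o
      (fun n => \int[P]_w (expR (- (u * V n w)))%:E)%E).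
    by apply: fine_cvg; exact: c.
  apply/funext => n /=.
  rewrite (@laplace_path_integral _ _ _ _ _ _ theta_sub _ n%:R expN_cont
    (fun s => expR_ge0 _) (ler0n _ _) u (ltW u0)) /=; congr (expR (- _)).
  rewrite /I Rintegral_itv_obnd_cbnd//.
  apply: (@integrableS _ _ _ leb `[0, n%:R]); try exact: measurable_itv.
    exact: subset_itv_oc_cc.
  apply: continuous_compact_integrable; first exact: segment_compact.
  exact: continuous_subspaceT.
have -> : (fun n : nat => \int[leb]_(s in `[0, n%:R])
    levy_exponent_ext rhoT (u * expR (- s))) = (fun n => - ln (expR (- I n))).
  by apply/funext => n; rewrite expRK opprK.
rewrite -[levy_exponent rho u]opprK -[X in - X]expRK.
apply: cvgN; apply: continuous_cvg => //.
by apply: continuous_ln; exact: expR_gt0.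
Qed.

End OU_exponent.

(** * The distribution of the short memory convoluted subordinator *)

Section independent_sum.
Context {R : realType} d (T : measurableType d) (P : probability T R).
Variables (X Y : increasing_process R T) (rhoX rhoY : R -> R).
Hypothesis subX : subordinator P X rhoX.
Hypothesis subY : subordinator P Y rhoY.
Hypothesis indXY : independent_processes P X Y.

Lemma laplace_independent_sum (s t u : R) : 0 <= s -> 0 <= t -> 0 <= u ->
  'E_P[fun w => expR (- (u * (X s w + Y t w)))]%E =
  (expR (- (s * levy_exponent rhoX u + t * levy_exponent rhoY u)))%:E.
Proof.
move=> s0 t0 u0; have [_ _ _ lapX] := subX; have [_ _ _ lapY] := subY.
pose W (i : nat) : T -> R := if i is 0%N then X s else Y t.
have mW i : measurable_fun [set: T] (W i).
  by case: i => [|i]; exact: ip_measurable.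
have W0 i w : 0 <= W i w by case: i => [|i]; exact: process_ge0.
pose g (x : R) : R := expR (- (u * Num.max 0 x)).
have mg : measurable_fun [set: R] g.
  by apply: measurable_expRNM => //; exact: measurable_maxr.
have g01 x : 0 <= g x <= 1.
  by rewrite expR_ge0/= -expR0 ler_expR oppr_le0 mulr_ge0// le_max lexx.
have gW i w : g (W i w) = expR (- (u * W i w)) by rewrite /g (max_idPr _).
have ind (B : nat -> set R) : (forall i, measurable (B i)) ->
    P (\bigcap_(i < 2) (W i @^-1` B i)) = (\prod_(i < 2) P (W i @^-1` B i))%E.
  move=> mB; rewrite !big_ord_recl big_ord0 mule1 /=.
  rewrite -indXY; last 2 first.
  - by apply: sub_sigma_algebra; exists s, (B 0%N).
  - by apply: sub_sigma_algebra; exists t, (B 1%N).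
  congr (P _); apply/seteqP; split => w.
    by move=> h; split; [exact: (h 0%N)|exact: (h 1%N)].
  by move=> [h0 h1] [|[|i]].
have := expectation_prod_independent mW ind (fun=> mg) (fun=> g01).
have gE : (fun w => (\prod_(i < 2) g (W i w))%R) =
    (fun w => expR (- (u * (X s w + Y t w)))).
  apply/funext => w; rewrite !big_ord_recl big_ord0 mulr1 !gW -expRD /=.
  by rewrite mulrDr opprD.
rewrite gE => ->; congr EFin; rewrite !big_ord_recl big_ord0 mulr1 /=.
have gXE : (fun w => g (X s w)) = (fun w => expR (- (u * X s w))).
  by apply/funext => w; exact: (gW 0%N).
have gYE : (fun w => g (Y t w)) = (fun w => expR (- (u * Y t w))).
  by apply/funext => w; exact: (gW 1%N).
by rewrite gXE gYE lapX// lapY//= -expRD opprD.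
Qed.

End independent_sum.

Theorem theorem9p1 (R : realType)
    (d : measure_display) (T : measurableType d) (P : probability T R)
    (zeta : increasing_process R T) (rho_zeta : R -> R)
    (dZ : measure_display) (TZ : measurableType dZ) (PZ : probability TZ R)
    (Z : increasing_process R TZ) (eps : R)
    (zeta_sub : subordinator P zeta rho_zeta)
    (zeta_sd : self_decomposable rho_zeta)
    (rho_diff : forall x : R, 0 < x -> derivable rho_zeta x 1)
    (Z_sub : subordinator PZ Z (fun x => - (x * derive1 rho_zeta x)))
    (eps_gt0 : 0 < eps) :
  [/\ (* the quantile clock has the marginals of zeta *)
      forall t : R, 0 <= t ->
        eq_law PZ (quantile_clock_U Z t) P (zeta t),
      (* rho_Z = rho_zeta + rho_theta *)
      forall (theta : increasing_process R T) (rho_theta : R -> R),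
        subordinator P theta rho_theta -> OU_BDLP P zeta theta ->
        {ae (@lebesgue_measure R), forall x : R, 0 < x ->
          - (x * derive1 rho_zeta x) = rho_zeta x + rho_theta x},
      (* (i) *)
      forall t : R, 0 <= t -> forall u : R, 0 <= u ->
        laplace_exponent PZ (short_memory_clock Z eps t) u =
        if t <= eps then t * levy_exponent rho_zeta (u * (t / eps))
        else t * levy_exponent rho_zeta u
             + (t - eps) * (u * derive1 (levy_exponent rho_zeta) u) &
      (* (ii) *)
      forall (theta : increasing_process R T) (rho_theta : R -> R),
        subordinator P theta rho_theta -> OU_BDLP P zeta theta ->
        independent_processes P zeta theta ->
        forall t : R, 0 <= t ->
        eq_law PZ (short_memory_clock Z eps t) P
          (fun w => if t <= eps then t / eps * zeta t w
                    else zeta t w + theta (t - eps) w)].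
Proof.
have [_ _ Lrho lap_zeta] := zeta_sub.
have [_ _ LZ _] := Z_sub.
pose psi := levy_exponent rho_zeta.
pose rhoZ x := - (x * derive1 rho_zeta x).
pose psiZ := levy_exponent_ext rhoZ.
have dpsi u : 0 < u -> derivable psi u 1 /\ u * derive1 psi u = psiZ u - psi u.
  exact: derivable_levy_exponent.
have clock_laplace t u : 0 <= t -> 0 <= u ->
    'E_PZ[fun w => expR (- (u * short_memory_clock Z eps t w))]%E =
    (expR (- (if t <= eps then t * psi (u * (t / eps))
              else eps * psi u + (t - eps) * psiZ u)))%:E.
  move=> t0 u0; have := @laplace_path_integral _ _ _ _ _ _ Z_sub _ t
    (@continuous_short_memory_kernel R eps t) (short_memory_kernel_ge0 eps_gt0 t)
    t0 u u0.
  by rewrite (short_memory_exponent zeta_sd rho_diff Lrho LZ)// unlock.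
have psi_theta theta rho_theta : subordinator P theta rho_theta ->
    OU_BDLP P zeta theta -> forall u, 0 <= u ->
    levy_exponent rho_theta u = psiZ u - psi u.
  move=> theta_sub OU u; have [_ _ Lth _] := theta_sub.
  rewrite le_eqVlt => /predU1P[<-|u0].
    by rewrite /psiZ levy_exponent_extE// /psi !levy_exponent0 subrr.
  rewrite -levy_exponent_extE ?ltW//.
  apply: (@exponent_of_OU_tail _ psi (fun u => psiZ u - psi u)) => //.
  - exact: continuous_levy_exponent_ext.
  - exact: levy_exponent_ext_ge0.
  - by move=> v v0; exact: (cvg_OU_exponent zeta_sub theta_sub OU).
split.
- move=> t t0; apply: eq_law_of_laplace.
  + exact: (@measurable_path_integral _ _ _ Z _ t (@continuous_quantile_kernel R t) t0).
  + exact: ip_measurable.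
  + by move=> w; apply: Rintegral_ge0 => s _; rewrite le_max lexx.
  + by move=> w; exact: process_ge0.
  + move=> u u0; have k0 (s : R) : 0 <= Num.max 0 (1 - s / t).
      by rewrite le_max lexx.
    have := @laplace_path_integral _ _ _ _ _ _ Z_sub _ t
      (@continuous_quantile_kernel R t) k0 t0 u u0.
    rewrite (quantile_clock_exponent zeta_sd rho_diff Lrho LZ)//.
    by rewrite lap_zeta// unlock.
- move=> theta rho_theta theta_sub OU; have [_ _ Lth _] := theta_sub.
  have Lsum : levy_density (fun x => rho_zeta x + rho_theta x).
    exact: levy_densityD.
  apply: levy_density_unique => // u u0.
  rewrite levy_exponentD// (psi_theta _ _ theta_sub OU)//.
  by rewrite /psiZ levy_exponent_extE// /psi; ring.
- move=> t t0 u u0; rewrite /laplace_exponent clock_laplace// expRK opprK.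
  case: ifP => // _; move: u0; rewrite le_eqVlt => /predU1P[<-|u0].
    by rewrite /psiZ levy_exponent_extE// /psi !levy_exponent0// mul0r !mulr0.
  by have [_ ->] := dpsi u u0; rewrite -/psi; ring.
- move=> theta rho_theta theta_sub OU indep t t0.
  have mclock : measurable_fun [set: TZ] (short_memory_clock Z eps t).
    exact: (@measurable_path_integral _ _ _ Z _ t
      (@continuous_short_memory_kernel R eps t) t0).
  have clock0 w : 0 <= short_memory_clock Z eps t w.
    by apply: Rintegral_ge0 => s _; exact: short_memory_kernel_ge0.
  have [te|et] := leP t eps.
    have te0 : 0 <= t / eps by rewrite divr_ge0// ltW.
    apply: eq_law_of_laplace => //.
    + by apply: measurable_funM => //; exact: ip_measurable.
    + by move=> w; rewrite mulr_ge0// process_ge0.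
    + move=> u u0; rewrite clock_laplace// te -(lap_zeta _ _ t0 (mulr_ge0 u0 te0)).
      rewrite (_ : (fun w => expR (- (u * (t / eps) * zeta t w))) =
        (fun w => expR (- (u * (t / eps * zeta t w)))))//.
      by apply/funext => w; rewrite -[u * _ * _]mulrA.
  have et0 : 0 <= t - eps by rewrite subr_ge0 ltW.
  apply: eq_law_of_laplace => //.
  + by apply: measurable_funD; exact: ip_measurable.
  + by move=> w; rewrite addr_ge0// process_ge0.
  + move=> u u0; rewrite clock_laplace// leNgt et/=.
    rewrite (laplace_independent_sum zeta_sub theta_sub)//.
    rewrite (psi_theta _ _ theta_sub OU)//; congr (expR (- _))%:E.
    by rewrite /psi; ring.
Qed.
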